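(* Let $\lambda\in\mathbb R\setminus\{0\}$, let $n>1$, let $Q=(Q_1,Q_2)$ with $Q_1,Q_2$ non-zero real homogeneous polynomials of degree $n$, and suppose that the system $\dot X=\lambda X+Q(X)$, $X=(x,y)\in\mathbb R^2$, has a heteroclinic cycle. Then a 1-parameter perturbation creates a limit cycle: there is a 1-parameter family $Q_\varepsilon$ of homogeneous polynomial vector fields of degree $n$, depending continuously on $\varepsilon$, with $Q_0=Q$, such that for all sufficiently small $\varepsilon>0$ the system $\dot X=\lambda X+Q_\varepsilon(X)$ has a limit cycle in $\mathbb R^2$.
   Context: A polycycle is a flow-invariant simple closed curve in the plane containing at least one equilibrium point and not going through the origin. A heteroclinic cycle is a polycycle in which all the trajectories that are not equilibria have the same orientation. *)

(* Defs.v *)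
From Stdlib Require Import Reals.
From Coquelicot Require Import Coquelicot.
Open Scope R_scope.

(* A real form (homogeneous polynomial) of degree n in (x, y) is given by its
   coefficients: a i, for i <= n, is the coefficient of x^i y^(n-i); the values
   of a beyond n are irrelevant. *)
Definition form (n : nat) (a : nat -> R) (p : R * R) : R :=
  sum_f_R0 (fun i => a i * fst p ^ i * snd p ^ (n - i)) n.

Definition nonzero_form (n : nat) (a : nat -> R) : Prop :=
  exists i : nat, (i <= n)%nat /\ a i <> 0.

Definition form_eq (n : nat) (a b : nat -> R) : Prop :=
  forall i : nat, (i <= n)%nat -> a i = b i.

Definition continuous_family (n : nat) (A : R -> nat -> R) : Prop :=
  forall i : nat, (i <= n)%nat ->
  forall eps : R, continuous (fun e : R => A e i) eps.

(* X |-> lambda X + Q(X), where Q has coefficients (a, b). *)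
Definition field (lambda : R) (n : nat) (a b : nat -> R) (p : R * R) : R * R :=
  (lambda * fst p + form n a p, lambda * snd p + form n b p).

Definition equilibrium (F : R * R -> R * R) (p : R * R) : Prop :=
  F p = (0, 0).

Definition complete_solution (F : R * R -> R * R) (phi : R -> R * R) : Prop :=
  forall t : R, is_derive phi t (F (phi t)).

(* Invariance under the flow in both time directions. Solutions of the
   (polynomial) systems considered are unique, so the complete solution below
   is the trajectory of p. *)
Definition flow_invariant (F : R * R -> R * R) (C : R * R -> Prop) : Prop :=
  forall p : R * R, C p ->
  exists phi : R -> R * R,
    complete_solution F phi /\ phi 0 = p /\ forall t : R, C (phi t).

(* Simple closed curves are parametrized by R/Z. *)
Definition simple_closed (c : R -> R * R) : Prop :=
  (forall s : R, continuous c s) /\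
  (forall s : R, c (s + 1) = c s) /\
  (forall s s' : R, 0 <= s < 1 -> 0 <= s' < 1 -> c s = c s' -> s = s').

Definition image (c : R -> R * R) (p : R * R) : Prop :=
  exists s : R, c s = p.

Definition polycycle (F : R * R -> R * R) (c : R -> R * R) : Prop :=
  simple_closed c /\
  flow_invariant F (image c) /\
  (exists p : R * R, image c p /\ equilibrium F p) /\
  ~ image c (0, 0).

(* phi runs along the closed curve c in the sense of increasing parameter: it
   has a continuous increasing lift to the universal cover R of R/Z. *)
Definition runs_along (c phi : R -> R * R) : Prop :=
  exists s : R -> R,
    (forall t : R, continuous s t) /\
    (forall t t' : R, t < t' -> s t < s t') /\
    (forall t : R, phi t = c (s t)).

Definition nonequilibrium_trajectory_in
    (F : R * R -> R * R) (C : R * R -> Prop) (phi : R -> R * R) : Prop :=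
  complete_solution F phi /\
  (forall t : R, C (phi t)) /\
  ~ equilibrium F (phi 0).

Definition heteroclinic_cycle (F : R * R -> R * R) (c : R -> R * R) : Prop :=
  polycycle F c /\
  ((forall phi : R -> R * R,
      nonequilibrium_trajectory_in F (image c) phi -> runs_along c phi) \/
   (forall phi : R -> R * R,
      nonequilibrium_trajectory_in F (image c) phi ->
      runs_along (fun s => c (- s)) phi)).

Definition periodic_orbit (F : R * R -> R * R) (G : R * R -> Prop) : Prop :=
  exists (phi : R -> R * R) (T : R),
    complete_solution F phi /\
    0 < T /\ (forall t : R, phi (t + T) = phi t) /\
    ~ equilibrium F (phi 0) /\
    (forall p : R * R, G p <-> image phi p).

(* Isolated periodic orbit: some neighbourhood meets no other one. *)
Definition limit_cycle (F : R * R -> R * R) (G : R * R -> Prop) : Prop :=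
  periodic_orbit F G /\
  exists U : R * R -> Prop,
    open U /\ (forall p : R * R, G p -> U p) /\
    forall G' : R * R -> Prop,
      periodic_orbit F G' -> (exists p : R * R, G' p /\ U p) ->
      forall p : R * R, G' p <-> G p.

(* Main.v *)
Require Import Defs.
From Stdlib Require Import Reals Lra Lia ZArith Classical_Prop ClassicalEpsilon.
From Coquelicot Require Import Coquelicot.
Open Scope R_scope.

(** Write n = N + 1.  In polar coordinates the system reads
    r' = lambda r + r^n f(theta), theta' = r^N g(theta), with f and g the
    radial and angular components of Q on the unit circle.  Where g does not
    vanish, v = r^N satisfies the linear equation
    dv/dtheta = N (lambda + f v) / g.

    A heteroclinic cycle imposes strong constraints
    ([heteroclinic_structure]).  Along the curve the angle moves in the direction
    given by the sign of g, so an angle passed upwards has g >= 0 and one passed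
    downwards has g <= 0.  A curve of winding number zero around the origin would
    pass some angle both ways, hence at points with g = 0; but on a ray with
    g = 0 the only trajectory bounded away from 0 and infinity is the unique
    equilibrium of that ray ([equilibrium_on_invariant_ray]), and a simple
    curve has no two such points.  So the curve winds around the origin, g has a
    constant weak sign sigma, and at every zero of g (there is one, at the
    equilibrium of the cycle) lambda f < 0.  Comparing antipodal zeros shows that
    n is odd ([degree_odd]).

    The perturbation adds sigma eps r^(n-1) (-y, x), which is polynomial since n
    is odd, leaves f unchanged and replaces g by g + sigma eps, without zeros.  As
    eps tends to 0, the integral of lambda f / (|g| + eps) over a period tends to
    minus infinity, because g is Lipschitz and lambda f < 0 at its zeros
    ([negative_over_angular_speed]).

    When that integral is negative the linear equation has a positive periodic
    solution ([periodic_linear_equation]).  It yields a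
    periodic orbit of the planar system; every other periodic orbit off the
    origin would give a second periodic solution ([periodic_orbit_unique]), so
    this one is isolated ([limit_cycle_exists]). *)

(** * Real analysis on segments *)

Lemma Derive_eta (f : R -> R) (x l : R) :
  is_derive f x l -> Derive (fun y : R => f y) x = l.
Proof. exact (is_derive_unique f x l). Qed.

(** Compactness of a segment as an induction principle: it replaces the choice
    of a finite subcover both in the construction of continuous angles and in
    the comparison of two functions on a period. *)
Lemma interval_induction (P : R -> R -> Prop) :
  (forall u v w, u <= v -> v <= w -> P u v -> P v w -> P u w) ->
  (forall x, exists d, 0 < d /\
     forall u v, x - d < u -> u <= v -> v < x + d -> P u v) ->
  forall u v, u <= v -> P u v.
Proof.
intros Hcat Hloc u v Huv.
assert (Puu : P u u).
{ destruct (Hloc u) as [d [Hd H]]; apply H; lra. }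
destruct (completeness (fun x => u <= x <= v /\ P u x)) as [T [HT1 HT2]].
- exists v; intros x [Hx _]; lra.
- exists u; split; [lra | exact Puu].
- assert (HuT : u <= T) by (apply HT1; split; [lra | exact Puu]).
  assert (HTv : T <= v) by (apply HT2; intros x [Hx _]; lra).
  destruct (Hloc T) as [d [Hd HlocT]].
  assert (Hx : exists x, (u <= x <= v /\ P u x) /\ T - d < x).
  { apply NNPP; intros Hno.
    assert (T <= T - d); [| lra].
    apply HT2; intros x Hx.
    destruct (Rle_lt_dec x (T - d)) as [|Hlt]; [assumption |].
    exfalso; apply Hno; exists x; split; assumption. }
  destruct Hx as [x [[Hux Pux] HTx]].
  assert (HxT : x <= T) by (apply HT1; split; assumption).
  pose (y := Rmin v (T + d / 2)).
  assert (Hy1 : y <= v) by apply Rmin_l.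
  assert (Hy2 : y <= T + d / 2) by apply Rmin_r.
  assert (Hy3 : T <= y) by (apply Rmin_glb; lra).
  assert (Puy : P u y).
  { apply Hcat with x; try lra; [exact Pux |].
    apply HlocT; lra. }
  assert (HyT : y <= T) by (apply HT1; split; [lra | exact Puy]).
  assert (y = v).
  { unfold y, Rmin in *; destruct (Rle_dec v (T + d / 2)); lra. }
  subst y; rewrite <- H; exact Puy.
Qed.

Lemma mean_value (f df : R -> R) (u v : R) :
  u < v -> (forall t, u <= t <= v -> is_derive f t (df t)) ->
  exists x, u <= x <= v /\ f v - f u = df x * (v - u).
Proof.
intros Huv Hf.
destruct (MVT_gen f u v df) as [x Hx];
  rewrite ?(Rmin_left u v), ?(Rmax_right u v) in * by lra.
- intros x Hx; apply Hf; lra.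
- intros x Hx; apply continuity_pt_filterlim.
  apply (ex_derive_continuous f); exists (df x); apply Hf; lra.
- exists x; exact Hx.
Qed.

Lemma derive_pos_increasing (f df : R -> R) (u v : R) :
  u < v -> (forall t, u <= t <= v -> is_derive f t (df t) /\ 0 < df t) ->
  f u < f v.
Proof.
intros Huv Hf.
destruct (mean_value f df u v Huv) as [x [Hx E]].
{ intros t Ht; apply Hf, Ht. }
assert (0 < df x * (v - u)); [| lra].
apply Rmult_lt_0_compat; [apply Hf, Hx | lra].
Qed.

Lemma derive_nonneg_increasing (f df : R -> R) (u v : R) :
  u <= v -> (forall t, u <= t <= v -> is_derive f t (df t) /\ 0 <= df t) ->
  f u <= f v.
Proof.
intros [Huv | ->] Hf; [| lra].
destruct (mean_value f df u v Huv) as [x [Hx E]].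
{ intros t Ht; apply Hf, Ht. }
assert (0 <= df x * (v - u)); [| lra].
apply Rmult_le_pos; [apply Hf, Hx | lra].
Qed.

Lemma derive_zero_const (f : R -> R) (u v : R) :
  u <= v -> (forall t, u <= t <= v -> is_derive f t 0) -> f u = f v.
Proof.
intros [Huv | ->] Hf; [| reflexivity].
apply (eq_is_derive f); assumption.
Qed.

Lemma derive_reflect (f : R -> R) (t l : R) :
  is_derive f (- t) l -> is_derive (fun s => f (- s)) t (- l).
Proof.
intros H.
replace (- l) with (scal (-1) l) by (unfold scal; simpl; unfold mult; simpl; ring).
apply (is_derive_comp f (fun s => - s)); [exact H |].
auto_derive; [trivial | ring].
Qed.

(** Gronwall: y^2 exp(-2Kt) is non-increasing, and it starts from zero. *)
Lemma gronwall_zero_right (y dy : R -> R) (K u v : R) :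
  u <= v ->
  (forall t, u <= t <= v -> is_derive y t (dy t) /\ Rabs (dy t) <= K * Rabs (y t)) ->
  y u = 0 -> y v = 0.
Proof.
intros Huv Hy Hu.
assert (H : - (exp (- (2 * K * u)) * (y u)²) <= - (exp (- (2 * K * v)) * (y v)²)).
{ apply derive_nonneg_increasing with
    (f := fun t => - (exp (- (2 * K * t)) * (y t)²))
    (df := fun t => exp (- (2 * K * t)) * (2 * (K * (y t)² - y t * dy t)));
    [exact Huv |].
  intros t Ht; destruct (Hy t Ht) as [D B]; split.
  - unfold Rsqr; auto_derive.
    + repeat split; exists (dy t); exact D.
    + rewrite (Derive_eta y t (dy t) D); ring.
  - apply Rmult_le_pos; [left; apply exp_pos |].
    apply Rmult_le_pos; [lra |].
    assert (y t * dy t <= K * (y t)²); [| lra].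
    apply Rle_trans with (1 := Rle_abs _).
    rewrite Rabs_mult, Rsqr_abs; unfold Rsqr.
    pose proof (Rabs_pos (y t)); nra. }
rewrite Hu in H; unfold Rsqr in H; rewrite Rmult_0_l, Rmult_0_r in H.
pose proof (exp_pos (- (2 * K * v))).
assert (y v * y v <= 0); [| nra].
apply Rnot_lt_le; intros Hlt.
pose proof (Rmult_lt_0_compat _ _ H0 Hlt); lra.
Qed.

Lemma gronwall_zero (y dy : R -> R) (K u v : R) :
  (forall t, Rmin u v <= t <= Rmax u v ->
     is_derive y t (dy t) /\ Rabs (dy t) <= K * Rabs (y t)) ->
  y u = 0 -> y v = 0.
Proof.
intros Hy Hu; destruct (Rle_lt_dec u v) as [Huv | Huv].
- rewrite Rmin_left, Rmax_right in Hy by lra.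
  exact (gronwall_zero_right y dy K u v Huv Hy Hu).
- rewrite Rmin_right, Rmax_left in Hy by lra.
  rewrite <- (Ropp_involutive v).
  apply (gronwall_zero_right (fun t => y (- t)) (fun t => - dy (- t)) K (- u) (- v));
    [lra | | now rewrite Ropp_involutive].
  intros t Ht; destruct (Hy (- t)) as [D B]; [lra |].
  split; [apply derive_reflect, D | now rewrite Rabs_Ropp].
Qed.

Lemma period_iterate (f : R -> R) (P K : R) :
  (forall x, f (x + P) = f x + K) ->
  forall (j : Z) x, f (x + IZR j * P) = f x + IZR j * K.
Proof.
intros H.
assert (HN : forall (m : nat) x, f (x + INR m * P) = f x + INR m * K).
{ induction m as [|m IH]; intros x.
  - simpl; rewrite !Rmult_0_l, !Rplus_0_r; reflexivity.
  - rewrite S_INR.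
    replace (x + (INR m + 1) * P) with (x + INR m * P + P) by ring.
    rewrite H, IH; ring. }
intros j x; destruct (Z_le_gt_dec 0 j) as [Hj | Hj].
- rewrite <- (Z2Nat.id j) by assumption; rewrite <- INR_IZR_INZ; apply HN.
- pose proof (HN (Z.to_nat (- j)) (x + IZR j * P)) as E.
  rewrite INR_IZR_INZ, Z2Nat.id, opp_IZR in E by lia.
  replace (x + IZR j * P + - IZR j * P) with x in E by ring.
  lra.
Qed.

Lemma period_iterate_curve (c : R -> R * R) (P : R) :
  (forall x, c (x + P) = c x) -> forall (j : Z) x, c (x + IZR j * P) = c x.
Proof.
intros H j x.
assert (H1 := period_iterate (fun s => fst (c s)) P 0).
assert (H2 := period_iterate (fun s => snd (c s)) P 0).
cbv beta in H1, H2.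
rewrite (surjective_pairing (c (x + _))), (surjective_pairing (c x)).
rewrite H1, H2, Rmult_0_r, !Rplus_0_r; [reflexivity | |];
  intros y; rewrite H; ring.
Qed.

Lemma period_representative (P lo x : R) :
  0 < P -> exists j : Z, lo <= x + IZR j * P < lo + P.
Proof.
intros HP.
destruct (base_fp ((x - lo) / P)) as [H1 H2].
exists (- Int_part ((x - lo) / P))%Z; rewrite opp_IZR.
unfold frac_part in *.
set (k := IZR (Int_part ((x - lo) / P))) in *.
assert (E : x - lo = (x - lo) / P * P) by (field; lra).
nra.
Qed.

Lemma pow_inj_pos (x y : R) (N : nat) :
  (0 < N)%nat -> 0 < x -> 0 < y -> x ^ N = y ^ N -> x = y.
Proof.
intros HN.
assert (Hlt : forall x y, 0 < x -> x < y -> x ^ N < y ^ N).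
{ clear x y; intros x y Hx Hxy; induction HN as [|m Hm IH]; simpl; [lra |].
  apply Rmult_gt_0_lt_compat; [apply pow_lt; assumption | lra | assumption | assumption]. }
intros Hx Hy E; destruct (Rtotal_order x y) as [H | [H | H]]; [| exact H |];
  apply Hlt in H; lra.
Qed.

(** Bounded Lipschitz functions form an algebra that contains cos and sin, hence
    every form restricted to the unit circle.  The Lipschitz constant serves in
    the uniqueness argument on invariant rays and in the lower bound of a
    divergent integral. *)
Definition lip (f : R -> R) : Prop :=
  exists K, 0 <= K /\
    forall x y, Rabs (f x) <= K /\ Rabs (f x - f y) <= K * Rabs (x - y).

Lemma lip_const (k : R) : lip (fun _ => k).
Proof.
exists (Rabs k); split; [apply Rabs_pos |].
intros x y; split; [lra |].
rewrite Rminus_diag, Rabs_R0.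
apply Rmult_le_pos; apply Rabs_pos.
Qed.

Lemma lip_plus (f g : R -> R) : lip f -> lip g -> lip (fun x => f x + g x).
Proof.
intros [K [HK Hf]] [L [HL Hg]]; exists (K + L); split; [lra |].
intros x y; destruct (Hf x y) as [A1 A2], (Hg x y) as [B1 B2]; split.
- apply Rle_trans with (1 := Rabs_triang _ _); lra.
- replace (f x + g x - (f y + g y)) with ((f x - f y) + (g x - g y)) by ring.
  apply Rle_trans with (1 := Rabs_triang _ _); lra.
Qed.

Lemma lip_mult (f g : R -> R) : lip f -> lip g -> lip (fun x => f x * g x).
Proof.
intros [K [HK Hf]] [L [HL Hg]]; exists (2 * (K * L)); split; [nra |].
intros x y; destruct (Hf x y) as [A1 A2], (Hg y x) as [B1 B2].
destruct (Hg x y) as [B3 B4].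
pose proof (Rabs_pos (x - y)); pose proof (Rabs_pos (f x));
pose proof (Rabs_pos (g y)); pose proof (Rabs_pos (g x));
pose proof (Rabs_pos (f x - f y)); pose proof (Rabs_pos (g x - g y)).
split.
- rewrite Rabs_mult; nra.
- replace (f x * g x - f y * g y) with (f x * (g x - g y) + (f x - f y) * g y) by ring.
  apply Rle_trans with (1 := Rabs_triang _ _); rewrite !Rabs_mult.
  assert (Rabs (f x) * Rabs (g x - g y) <= K * (L * Rabs (x - y))).
  { apply Rmult_le_compat; assumption. }
  assert (Rabs (f x - f y) * Rabs (g y) <= K * Rabs (x - y) * L).
  { apply Rmult_le_compat; assumption. }
  nra.
Qed.

Lemma lip_pow (f : R -> R) (k : nat) : lip f -> lip (fun x => f x ^ k).
Proof.
intros Hf; induction k as [|k IH]; simpl; [apply lip_const |].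
apply lip_mult; assumption.
Qed.

Lemma lip_of_derive (f df : R -> R) :
  (forall x, is_derive f x (df x)) -> (forall x, Rabs (f x) <= 1) ->
  (forall x, Rabs (df x) <= 1) -> lip f.
Proof.
intros D B1 B2; exists 1; split; [lra |].
intros x y; split; [apply B1 |].
destruct (MVT_gen f y x df) as [z [Hz ->]].
- intros; apply D.
- intros z _; apply continuity_pt_filterlim.
  apply (ex_derive_continuous f); exists (df z); apply D.
- rewrite Rabs_mult.
  apply Rmult_le_compat_r; [apply Rabs_pos | apply B2].
Qed.

Lemma lip_cos : lip cos.
Proof.
apply lip_of_derive with (fun x => - sin x).
- intros x; apply is_derive_cos.
- intros x; apply Rabs_le; pose proof (COS_bound x); lra.
- intros x; rewrite Rabs_Ropp; apply Rabs_le; pose proof (SIN_bound x); lra.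
Qed.

Lemma lip_sin : lip sin.
Proof.
apply lip_of_derive with cos.
- intros x; apply is_derive_sin.
- intros x; apply Rabs_le; pose proof (SIN_bound x); lra.
- intros x; apply Rabs_le; pose proof (COS_bound x); lra.
Qed.

Lemma eps_continuous (f : R -> R) (x : R) :
  (forall e, 0 < e -> exists d, 0 < d /\
     forall y, Rabs (y - x) < d -> Rabs (f y - f x) < e) ->
  continuous f x.
Proof.
intros H; apply filterlim_locally; intros e.
destruct (H e (cond_pos e)) as [d [Hd Hy]].
exists (mkposreal d Hd); intros y By; apply Hy, By.
Qed.

Lemma continuous_eps (f : R -> R) (x : R) :
  continuous f x ->
  forall e, 0 < e -> exists d, 0 < d /\
     forall y, Rabs (y - x) < d -> Rabs (f y - f x) < e.
Proof.
intros H e He.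
destruct (proj1 (filterlim_locally _ _) H (mkposreal e He)) as [d Hd].
exists d; split; [apply cond_pos | intros y Hy; apply (Hd y Hy)].
Qed.

Lemma lip_continuous (f : R -> R) (x : R) : lip f -> continuous f x.
Proof.
intros [K [HK Hf]]; apply eps_continuous; intros e He.
exists (e / (K + 1)); split; [apply Rdiv_lt_0_compat; lra |].
intros y Hy; apply Rle_lt_trans with (1 := proj2 (Hf y x)).
apply Rle_lt_trans with ((K + 1) * Rabs (y - x)).
- apply Rmult_le_compat_r; [apply Rabs_pos | lra].
- apply Rmult_lt_reg_l with (/ (K + 1)); [apply Rinv_0_lt_compat; lra |].
  rewrite <- Rmult_assoc, Rinv_l, Rmult_1_l by lra.
  unfold Rdiv in Hy; lra.
Qed.

Lemma continuous_pos_near (f : R -> R) (x : R) :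
  continuous f x -> 0 < f x ->
  exists d, 0 < d /\ forall y, Rabs (y - x) < d -> 0 < f y.
Proof.
intros Hf Hp; destruct (continuous_eps f x Hf (f x) Hp) as [d [Hd H]].
exists d; split; [exact Hd |].
intros y Hy; specialize (H y Hy); apply Rabs_def2 in H; lra.
Qed.

Lemma continuous_bounded (f : R -> R) (u v : R) :
  (forall x, u <= x <= v -> continuous f x) ->
  exists M, 0 < M /\ forall x, u <= x <= v -> f x <= M.
Proof.
intros Hf; destruct (Rle_lt_dec u v) as [Huv | Huv].
- destruct (continuity_ab_maj f u v Huv) as [m [Hm _]].
  { intros x Hx; apply continuity_pt_filterlim, Hf, Hx. }
  exists (Rmax 1 (f m)); split.
  + apply Rlt_le_trans with 1; [lra | apply Rmax_l].
  + intros x Hx; apply Rle_trans with (f m); [apply Hm, Hx | apply Rmax_r].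
- exists 1; split; [lra | intros; lra].
Qed.

(** * Continuous polar angles of plane curves *)

Definition rad (p : R * R) : R := sqrt (fst p * fst p + snd p * snd p).

Definition polar (r th : R) : R * R := (r * cos th, r * sin th).

Lemma cos_sin_sq (th : R) : cos th * cos th + sin th * sin th = 1.
Proof. pose proof (sin2_cos2 th) as H; unfold Rsqr in H; lra. Qed.

Lemma sqr_sum_pos (p : R * R) :
  p <> (0, 0) -> 0 < fst p * fst p + snd p * snd p.
Proof.
destruct p as [x y]; simpl; intros H.
destruct (Req_dec x 0) as [-> | Hx].
- destruct (Req_dec y 0) as [-> | Hy]; [now elim H | nra].
- nra.
Qed.

Lemma rad_pos (p : R * R) : p <> (0, 0) -> 0 < rad p.
Proof. intros H; apply sqrt_lt_R0, sqr_sum_pos, H. Qed.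

Lemma rad_sqr (p : R * R) : rad p * rad p = fst p * fst p + snd p * snd p.
Proof. apply sqrt_sqrt; nra. Qed.

Lemma polar_nonzero (r th : R) : 0 < r -> polar r th <> (0, 0).
Proof.
intros Hr E; injection E; intros E2 E1.
apply Rmult_integral in E1; apply Rmult_integral in E2.
pose proof (cos_sin_sq th); destruct E1, E2; nra.
Qed.

Lemma rad_polar (r th : R) : 0 <= r -> rad (polar r th) = r.
Proof.
intros Hr; unfold rad; simpl.
replace (_ + _) with (r * r * (cos th * cos th + sin th * sin th)) by ring.
rewrite cos_sin_sq, Rmult_1_r; apply sqrt_square, Hr.
Qed.

Lemma polar_unit (r th th' : R) :
  cos th = cos th' -> sin th = sin th' -> polar r th = polar r th'.
Proof. unfold polar; intros -> ->; reflexivity. Qed.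

Lemma polar_add_two_pi (r th : R) (j : Z) :
  polar r (th + IZR j * (2 * PI)) = polar r th.
Proof.
apply (period_iterate_curve (polar r)); intros x; apply polar_unit.
- rewrite cos_plus, cos_2PI, sin_2PI; ring.
- rewrite sin_plus, cos_2PI, sin_2PI; ring.
Qed.

Lemma polar_same_angle (r r' th th' : R) :
  0 < r -> 0 < r' -> polar r th = polar r' th' ->
  exists j : Z, th' = th + IZR j * (2 * PI).
Proof.
intros Hr Hr' E.
assert (r = r') as <-.
{ rewrite <- (rad_polar r th), <- (rad_polar r' th') by lra; now rewrite E. }
injection E; intros E2 E1.
apply Rmult_eq_reg_l in E1; [| lra]; apply Rmult_eq_reg_l in E2; [| lra].
destruct (period_representative (2 * PI) 0 (th' - th)) as [j Hj].
{ pose proof PI_RGT_0; lra. }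
set (w := th' - th + IZR j * (2 * PI)) in *.
assert (Hc : cos w = 1).
{ assert (Ew : polar 1 w = polar 1 (th' - th)) by apply polar_add_two_pi.
  injection Ew; intros _ Ec; rewrite !Rmult_1_l in Ec.
  rewrite Ec, cos_minus, E1, E2; apply cos_sin_sq. }
assert (Hw : w = 0).
{ destruct (Req_dec w 0) as [|Hw]; [assumption | exfalso].
  assert (0 < sin (w / 2)) by (apply sin_gt_0; lra).
  replace w with (2 * (w / 2)) in Hc by field.
  rewrite cos_2a_sin in Hc; nra. }
exists (- j)%Z; rewrite opp_IZR; unfold w in Hw; lra.
Qed.

(** Coordinates in the orthonormal basis whose first vector has direction th0.
    In the half-plane where the first one is positive the angle is th0 plus an
    arctangent, whence its continuity and differentiability. *)
Definition along (th0 : R) (p : R * R) : R := fst p * cos th0 + snd p * sin th0.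
Definition across (th0 : R) (p : R * R) : R := snd p * cos th0 - fst p * sin th0.

Lemma polar_half_plane (th0 : R) (p : R * R) :
  0 < along th0 p ->
  p = polar (rad p) (th0 + atan (across th0 p / along th0 p)).
Proof.
intros Hd.
assert (Ex : fst p = along th0 p * cos th0 - across th0 p * sin th0).
{ unfold along, across; transitivity (fst p * (cos th0 * cos th0 + sin th0 * sin th0));
    [rewrite cos_sin_sq; ring | ring]. }
assert (Ey : snd p = along th0 p * sin th0 + across th0 p * cos th0).
{ unfold along, across; transitivity (snd p * (cos th0 * cos th0 + sin th0 * sin th0));
    [rewrite cos_sin_sq; ring | ring]. }
set (d := along th0 p) in *; set (e := across th0 p) in *; clearbody d e.
assert (Hs : 0 < sqrt (1 + (e / d)²)).
{ apply sqrt_lt_R0; pose proof (Rle_0_sqr (e / d)); lra. }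
assert (Er : rad p = d * sqrt (1 + (e / d)²)).
{ unfold rad; rewrite Ex, Ey.
  replace (_ + _) with (d * d * (1 + (e / d)²)).
  - rewrite sqrt_mult_alt, sqrt_square by nra; reflexivity.
  - transitivity ((d * d + e * e) * (cos th0 * cos th0 + sin th0 * sin th0)).
    + rewrite cos_sin_sq; unfold Rsqr; field; lra.
    + ring. }
rewrite (surjective_pairing p) at 1; unfold polar.
rewrite cos_plus, sin_plus, cos_atan, sin_atan, Er, Ex, Ey.
f_equal; field; split; lra.
Qed.

(** The open half-planes around the four axis directions cover the punctured
    plane. *)
Lemma angle_exists (p : R * R) : p <> (0, 0) -> exists th, p = polar (rad p) th.
Proof.
intros Hp; destruct (Rlt_le_dec 0 (along 0 p)) as [H | H].
{ eexists; apply (polar_half_plane 0), H. }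
destruct (Rlt_le_dec 0 (along PI p)) as [H1 | H1].
{ eexists; apply (polar_half_plane PI), H1. }
destruct (Rlt_le_dec 0 (along (PI / 2) p)) as [H2 | H2].
{ eexists; apply (polar_half_plane (PI / 2)), H2. }
destruct (Rlt_le_dec 0 (along (- (PI / 2)) p)) as [H3 | H3].
{ eexists; apply (polar_half_plane (- (PI / 2))), H3. }
elim Hp; unfold along in *.
rewrite cos_0, sin_0 in H; rewrite cos_PI, sin_PI in H1.
rewrite cos_PI2, sin_PI2 in H2; rewrite cos_neg, sin_neg, cos_PI2, sin_PI2 in H3.
rewrite (surjective_pairing p); f_equal; lra.
Qed.

(** Continuity is required on the whole line, with arbitrary values outside
    [u, v], so that no one-sided limits occur at the endpoints. *)
Definition angle_lift (X : R -> R * R) (th : R -> R) (u v : R) : Prop :=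
  (forall s, continuous th s) /\
  (forall s, u <= s <= v -> X s = polar (rad (X s)) (th s)).

Lemma clamp_continuous (u v s : R) : u <= v -> continuous (fun s => Rmax u (Rmin s v)) s.
Proof.
intros Huv; apply eps_continuous; intros e He; exists e; split; [exact He |].
intros y Hy; apply Rle_lt_trans with (2 := Hy).
unfold Rmin; destruct (Rle_dec y v), (Rle_dec s v); unfold Rmax, Rabs;
repeat match goal with
  | |- context [Rle_dec ?a ?b] => destruct (Rle_dec a b)
  | |- context [Rcase_abs ?a] => destruct (Rcase_abs a)
  end; lra.
Qed.

Lemma clamp_id (u v s : R) : u <= s <= v -> Rmax u (Rmin s v) = s.
Proof. intros; rewrite Rmin_left, Rmax_right; lra. Qed.

Lemma clamp_in (u v s : R) : u <= v -> u <= Rmax u (Rmin s v) <= v.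
Proof.
intros; split; [apply Rmax_l |].
apply Rmax_lub; [assumption | apply Rmin_r].
Qed.

Definition curve_continuous (X : R -> R * R) : Prop :=
  forall s, continuous (fun s => fst (X s)) s /\ continuous (fun s => snd (X s)) s.

Lemma continuous_along (X : R -> R * R) (th0 s : R) :
  curve_continuous X -> continuous (fun s => along th0 (X s)) s.
Proof.
intros HX; unfold along.
apply @continuous_plus; (apply @continuous_mult; [apply HX | apply continuous_const]).
Qed.

Lemma continuous_across (X : R -> R * R) (th0 s : R) :
  curve_continuous X -> continuous (fun s => across th0 (X s)) s.
Proof.
intros HX; unfold across.
apply @continuous_minus; (apply @continuous_mult; [apply HX | apply continuous_const]).
Qed.

Lemma continuous_quotient_angle (X : R -> R * R) (th0 s : R) :
  curve_continuous X -> 0 < along th0 (X s) ->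
  continuous (fun s => th0 + atan (across th0 (X s) / along th0 (X s))) s.
Proof.
intros HX Hd.
apply @continuous_plus; [apply continuous_const |].
apply (continuous_comp (fun s => across th0 (X s) / along th0 (X s)) atan).
- apply @continuous_mult; [now apply continuous_across |].
  apply continuous_Rinv_comp; [now apply continuous_along | lra].
- apply continuity_pt_filterlim, derivable_continuous_pt, derivable_pt_atan.
Qed.

Lemma along_polar (r th th0 : R) : along th0 (polar r th) = r * cos (th - th0).
Proof. unfold along, polar; simpl; rewrite cos_minus; ring. Qed.

Lemma across_polar (r th th0 : R) : across th0 (polar r th) = r * sin (th - th0).
Proof. unfold across, polar; simpl; rewrite sin_minus; ring. Qed.

Lemma along_self (p : R * R) (th0 : R) :
  p <> (0, 0) -> p = polar (rad p) th0 -> 0 < along th0 p.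
Proof.
intros Hp E; rewrite E, along_polar, Rminus_diag, cos_0, Rmult_1_r.
apply rad_pos, Hp.
Qed.

(** Angles exist locally by the arctangent formula, and two lifts over adjacent
    segments differ by a multiple of 2 pi at the common endpoint, so they can be
    glued. *)
Lemma angle_lift_exists (X : R -> R * R) (u v : R) :
  curve_continuous X -> (forall s, X s <> (0, 0)) -> u <= v ->
  exists th, angle_lift X th u v.
Proof.
intros HX Hnz; revert u v.
apply (interval_induction (fun u v => exists th, angle_lift X th u v)).
- intros u v w Huv Hvw [th1 [C1 L1]] [th2 [C2 L2]].
  destruct (polar_same_angle (rad (X v)) (rad (X v)) (th1 v) (th2 v)) as [j Hj].
  { apply rad_pos, Hnz. }
  { apply rad_pos, Hnz. }
  { rewrite <- L1, <- L2 by lra; reflexivity. }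
  (* the second angle is shifted by a multiple of 2 pi to agree at v *)
  exists (fun s => th1 (Rmax u (Rmin s v)) + (th2 (Rmax v (Rmin s w)) - th2 v)).
  split.
  + intros s; apply @continuous_plus; [| apply @continuous_minus; [| apply continuous_const]].
    * apply (continuous_comp (fun s => Rmax u (Rmin s v)) th1);
        [now apply clamp_continuous | apply C1].
    * apply (continuous_comp (fun s => Rmax v (Rmin s w)) th2);
        [now apply clamp_continuous | apply C2].
  + intros s Hs; destruct (Rle_lt_dec s v) as [Hsv | Hsv].
    * rewrite clamp_id, (Rmin_left s w), (Rmax_left v s) by lra.
      rewrite Rminus_diag, Rplus_0_r; apply L1; lra.
    * rewrite (clamp_id v w), (Rmin_right s v), (Rmax_right u v) by lra.
      replace (th1 v + (th2 s - th2 v)) with (th2 s + IZR (- j) * (2 * PI))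
        by (rewrite opp_IZR; lra).
      rewrite polar_add_two_pi; apply L2; lra.
- intros s0; destruct (angle_exists (X s0) (Hnz s0)) as [th0 E0].
  assert (H0 := along_self _ _ (Hnz s0) E0).
  destruct (continuous_pos_near (fun s => along th0 (X s)) s0) as [d [Hd Hpos]];
    [now apply continuous_along | exact H0 |].
  exists d; split; [exact Hd |].
  intros u v Hu Huv Hv.
  exists (fun s => let s' := Rmax u (Rmin s v) in
            th0 + atan (across th0 (X s') / along th0 (X s'))); split.
  + intros s.
    apply (continuous_comp (fun s => Rmax u (Rmin s v))
      (fun s => th0 + atan (across th0 (X s) / along th0 (X s))));
      [now apply clamp_continuous |].
    apply continuous_quotient_angle; [exact HX |].
    apply Hpos, Rabs_def1; pose proof (clamp_in u v s Huv); lra.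
  + intros s Hs; cbv zeta; rewrite clamp_id by lra.
    apply polar_half_plane, Hpos, Rabs_def1; lra.
Qed.

Lemma derive_linear_combination (x y : R -> R) (t dx dy p q : R) :
  is_derive x t dx -> is_derive y t dy ->
  is_derive (fun s => x s * p + y s * q) t (dx * p + dy * q).
Proof.
intros Dx Dy; auto_derive.
- repeat split; [exists dx; exact Dx | exists dy; exact Dy].
- rewrite (Derive_eta _ _ _ Dx), (Derive_eta _ _ _ Dy); ring.
Qed.

Lemma derive_atan_quotient (e d : R -> R) (th0 t de dd : R) :
  is_derive e t de -> is_derive d t dd -> 0 < d t -> e t = 0 ->
  is_derive (fun s => th0 + atan (e s / d s)) t (de / d t).
Proof.
intros De Dd Hd He; auto_derive.
- repeat split; [exists de; exact De | exists dd; exact Dd | lra].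
- rewrite (Derive_eta _ _ _ De), (Derive_eta _ _ _ Dd), He; field; lra.
Qed.

(** Near t the lift stays within pi/2 of th t, so there it coincides with the
    arctangent formula based at th t. *)
Lemma angle_lift_derive (X : R -> R * R) (th : R -> R) (u v t dx dy : R) :
  curve_continuous X -> (forall s, u <= s <= v -> X s <> (0, 0)) ->
  angle_lift X th u v -> u < t < v ->
  is_derive (fun s => fst (X s)) t dx -> is_derive (fun s => snd (X s)) t dy ->
  is_derive th t ((fst (X t) * dy - snd (X t) * dx) / (rad (X t) * rad (X t))).
Proof.
intros HX Hnz [Cth Lth] Ht Dx Dy.
assert (Et := Lth t ltac:(lra)).
assert (Nt := Hnz t ltac:(lra)).
assert (Hr := rad_pos _ Nt).
set (th0 := th t) in *.
assert (Hd := along_self _ _ Nt Et).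
apply is_derive_ext_loc with
  (fun s => th0 + atan (across th0 (X s) / along th0 (X s))).
- destruct (continuous_eps th t (Cth t) (PI / 2)) as [d [Hdp Hd']].
  { pose proof PI_RGT_0; lra. }
  assert (Hm : 0 < Rmin d (Rmin (t - u) (v - t))).
  { repeat apply Rmin_pos; lra. }
  exists (mkposreal _ Hm); intros s Hs.
  assert (Hs' : Rabs (s - t) < Rmin d (Rmin (t - u) (v - t))) by exact Hs.
  assert (Rabs (s - t) < d) by (eapply Rlt_le_trans; [exact Hs' | apply Rmin_l]).
  assert (Rabs (s - t) < Rmin (t - u) (v - t)) as H1
    by (eapply Rlt_le_trans; [exact Hs' | apply Rmin_r]).
  assert (Rabs (s - t) < t - u) as H2 by (eapply Rlt_le_trans; [exact H1 | apply Rmin_l]).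
  assert (Rabs (s - t) < v - t) as H3 by (eapply Rlt_le_trans; [exact H1 | apply Rmin_r]).
  apply Rabs_def2 in H2; apply Rabs_def2 in H3.
  assert (Hb := Hd' s H); fold th0 in Hb; apply Rabs_def2 in Hb.
  assert (Ns := rad_pos _ (Hnz s ltac:(lra))).
  rewrite (Lth s) by lra; rewrite along_polar, across_polar.
  assert (0 < cos (th s - th0)) by (apply cos_gt_0; lra).
  replace (rad (X s) * sin (th s - th0) / (rad (X s) * cos (th s - th0)))
    with (tan (th s - th0)) by (unfold tan; field; split; lra).
  rewrite atan_tan by lra.
  change (th0 + (th s - th0) = th s); ring.
- assert (Dal : is_derive (fun s => along th0 (X s)) t (dx * cos th0 + dy * sin th0))
    by exact (derive_linear_combination _ _ t dx dy _ _ Dx Dy).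
  assert (Dac : is_derive (fun s => across th0 (X s)) t (dy * cos th0 + dx * - sin th0)).
  { apply is_derive_ext with (fun s => snd (X s) * cos th0 + fst (X s) * - sin th0).
    - intros s; unfold across; change ((snd (X s) * cos th0 + fst (X s) * - sin th0)
        = snd (X s) * cos th0 - fst (X s) * sin th0); ring.
    - exact (derive_linear_combination _ _ t dy dx _ _ Dy Dx). }
  assert (Eal : along th0 (X t) = rad (X t))
    by (rewrite Et at 1; rewrite along_polar, Rminus_diag, cos_0; ring).
  assert (Eac : across th0 (X t) = 0)
    by (rewrite Et; rewrite across_polar, Rminus_diag, sin_0; ring).
  assert (Ex : fst (X t) = rad (X t) * cos th0) by (rewrite Et at 1; reflexivity).
  assert (Ey : snd (X t) = rad (X t) * sin th0) by (rewrite Et at 1; reflexivity).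
  replace ((fst (X t) * dy - snd (X t) * dx) / (rad (X t) * rad (X t)))
    with ((dy * cos th0 + dx * - sin th0) / along th0 (X t)).
  + exact (derive_atan_quotient _ _ th0 t _ _ Dac Dal Hd Eac).
  + rewrite Eal, Ex, Ey; field; lra.
Qed.

(** * Homogeneous vector fields in polar coordinates *)

Lemma form_homogeneous (n : nat) (a : nat -> R) (r x y : R) :
  form n a (r * x, r * y) = r ^ n * form n a (x, y).
Proof.
unfold form; rewrite scal_sum; apply sum_eq; intros i Hi; simpl.
rewrite !Rpow_mult_distr.
replace (r ^ n) with (r ^ i * r ^ (n - i)) by (rewrite <- pow_add; f_equal; lia).
ring.
Qed.

Lemma form_polar (n : nat) (a : nat -> R) (r th : R) :
  form n a (polar r th) = r ^ n * form n a (cos th, sin th).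
Proof. apply form_homogeneous. Qed.

Lemma form_origin (n : nat) (a : nat -> R) : (0 < n)%nat -> form n a (0, 0) = 0.
Proof.
intros Hn; replace (0, 0) with (0 * 0, 0 * 0) by (f_equal; ring).
rewrite form_homogeneous, pow_i by exact Hn; ring.
Qed.

Lemma form_circle_lip (n : nat) (a : nat -> R) :
  lip (fun th => form n a (cos th, sin th)).
Proof.
unfold form; simpl.
assert (H : forall m, lip (fun th =>
  sum_f_R0 (fun i => a i * cos th ^ i * sin th ^ (n - i)) m)).
{ assert (Hi : forall i, lip (fun th => a i * cos th ^ i * sin th ^ (n - i))).
  { intros i; apply lip_mult; [apply lip_mult; [apply lip_const |] |];
      apply lip_pow; [apply lip_cos | apply lip_sin]. }
  induction m as [|m IH]; simpl; [apply Hi | apply lip_plus; [exact IH | apply Hi]]. }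
apply H.
Qed.

Definition radial (n : nat) (a b : nat -> R) (th : R) : R :=
  cos th * form n a (cos th, sin th) + sin th * form n b (cos th, sin th).

Definition angular (n : nat) (a b : nat -> R) (th : R) : R :=
  cos th * form n b (cos th, sin th) - sin th * form n a (cos th, sin th).

Lemma radial_lip (n : nat) (a b : nat -> R) : lip (radial n a b).
Proof.
apply lip_plus; apply lip_mult; auto using lip_cos, lip_sin, form_circle_lip.
Qed.

Lemma angular_lip (n : nat) (a b : nat -> R) : lip (angular n a b).
Proof.
assert (H : lip (fun th => cos th * form n b (cos th, sin th)
                  + (-1) * (sin th * form n a (cos th, sin th)))).
{ apply lip_plus; [| apply lip_mult; [apply lip_const |]];
    apply lip_mult; auto using lip_cos, lip_sin, form_circle_lip. }
destruct H as [K [HK H]]; exists K; split; [exact HK |].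
intros x y; specialize (H x y); unfold angular.
replace (cos x * _ - _) with (cos x * form n b (cos x, sin x)
  + (-1) * (sin x * form n a (cos x, sin x))) by ring.
replace (cos y * _ - _) with (cos y * form n b (cos y, sin y)
  + (-1) * (sin y * form n a (cos y, sin y))) by ring.
exact H.
Qed.

Lemma unit_point_shift (th : R) (j : Z) :
  (cos (th + IZR j * (2 * PI)), sin (th + IZR j * (2 * PI))) = (cos th, sin th).
Proof.
pose proof (polar_add_two_pi 1 th j) as H; unfold polar in H.
rewrite !Rmult_1_l in H; exact H.
Qed.

Lemma radial_period (n : nat) (a b : nat -> R) (th : R) (j : Z) :
  radial n a b (th + IZR j * (2 * PI)) = radial n a b th.
Proof.
unfold radial; rewrite unit_point_shift.
injection (unit_point_shift th j); intros -> ->; reflexivity.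
Qed.

Lemma angular_period (n : nat) (a b : nat -> R) (th : R) (j : Z) :
  angular n a b (th + IZR j * (2 * PI)) = angular n a b th.
Proof.
unfold angular; rewrite unit_point_shift.
injection (unit_point_shift th j); intros -> ->; reflexivity.
Qed.

Lemma form_frame_fst (n : nat) (a b : nat -> R) (r th : R) :
  form n a (polar r th)
  = r ^ n * (radial n a b th * cos th - angular n a b th * sin th).
Proof.
rewrite form_polar; unfold radial, angular; f_equal.
transitivity (form n a (cos th, sin th) * (cos th * cos th + sin th * sin th));
  [rewrite cos_sin_sq; ring | ring].
Qed.

Lemma form_frame_snd (n : nat) (a b : nat -> R) (r th : R) :
  form n b (polar r th)
  = r ^ n * (radial n a b th * sin th + angular n a b th * cos th).
Proof.
rewrite form_polar; unfold radial, angular; f_equal.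
transitivity (form n b (cos th, sin th) * (cos th * cos th + sin th * sin th));
  [rewrite cos_sin_sq; ring | ring].
Qed.

Lemma field_origin (lambda : R) (n : nat) (a b : nat -> R) :
  (0 < n)%nat -> equilibrium (field lambda n a b) (0, 0).
Proof.
intros Hn; unfold equilibrium, field; simpl; rewrite !form_origin by exact Hn.
f_equal; ring.
Qed.

Lemma equilibrium_polar (lambda : R) (N : nat) (a b : nat -> R) (r th : R) :
  0 < r ->
  equilibrium (field lambda (S N) a b) (polar r th) <->
  lambda + r ^ N * radial (S N) a b th = 0 /\ angular (S N) a b th = 0.
Proof.
intros Hr.
assert (HrN : 0 < r ^ S N) by now apply pow_lt.
unfold equilibrium, field.
rewrite (form_frame_fst _ a b), (form_frame_snd _ a b); simpl fst; simpl snd.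
set (f := radial (S N) a b th); set (g := angular (S N) a b th).
pose proof (cos_sin_sq th) as H1; simpl (r ^ S N) in *.
split.
- intros E; injection E; intros E2 E1.
  assert (F : r * (lambda + r ^ N * f) = 0).
  { transitivity (r * (lambda + r ^ N * f) * (cos th * cos th + sin th * sin th));
      [rewrite H1; ring |].
    transitivity ((lambda * (r * cos th) + r * r ^ N * (f * cos th - g * sin th)) * cos th
      + (lambda * (r * sin th) + r * r ^ N * (f * sin th + g * cos th)) * sin th);
      [ring | rewrite E1, E2; ring]. }
  assert (G : r * r ^ N * g = 0).
  { transitivity (r * r ^ N * g * (cos th * cos th + sin th * sin th));
      [rewrite H1; ring |].
    transitivity ((lambda * (r * sin th) + r * r ^ N * (f * sin th + g * cos th)) * cos th
      - (lambda * (r * cos th) + r * r ^ N * (f * cos th - g * sin th)) * sin th);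
      [ring | rewrite E1, E2; ring]. }
  apply Rmult_integral in F; apply Rmult_integral in G.
  split; [destruct F | destruct G]; lra.
- intros [F ->].
  f_equal.
  + transitivity (r * cos th * (lambda + r ^ N * f)); [ring | rewrite F; ring].
  + transitivity (r * sin th * (lambda + r ^ N * f)); [ring | rewrite F; ring].
Qed.

Lemma derive_fst (phi : R -> R * R) (t : R) (l : R * R) :
  is_derive phi t l -> is_derive (fun s => fst (phi s)) t (fst l).
Proof.
intros H.
exact (filterdiff_comp' phi (fun q : R * R => fst q) t _ _ H
  (filterdiff_linear _ is_linear_fst)).
Qed.

Lemma derive_snd (phi : R -> R * R) (t : R) (l : R * R) :
  is_derive phi t l -> is_derive (fun s => snd (phi s)) t (snd l).
Proof.
intros H.
exact (filterdiff_comp' phi (fun q : R * R => snd q) t _ _ H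
  (filterdiff_linear _ is_linear_snd)).
Qed.

Lemma derive_pair (x y : R -> R) (t dx dy : R) :
  is_derive x t dx -> is_derive y t dy ->
  is_derive (fun s => (x s, y s) : R * R) t (dx, dy).
Proof.
intros Dx Dy.
apply is_derive_ext with
  (fun s => plus (scal (x s) ((1, 0) : R * R)) (scal (y s) ((0, 1) : R * R))).
- intros s; unfold plus, scal; simpl; unfold prod_plus, prod_scal; simpl.
  unfold plus, scal; simpl; unfold mult; simpl; f_equal; ring.
- replace ((dx, dy) : R * R)
    with (plus (scal dx ((1, 0) : R * R)) (scal dy ((0, 1) : R * R))).
  + apply @is_derive_plus; apply @is_derive_scal_l; assumption.
  + unfold plus, scal; simpl; unfold prod_plus, prod_scal; simpl.
    unfold plus, scal; simpl; unfold mult; simpl; f_equal; ring.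
Qed.

Lemma curve_continuous_of_continuous (c : R -> R * R) :
  (forall s, continuous c s) -> curve_continuous c.
Proof.
intros Hc s; split.
- apply (continuous_comp c (fun q : R * R => fst q)); [apply Hc | apply continuous_fst].
- apply (continuous_comp c (fun q : R * R => snd q)); [apply Hc | apply continuous_snd].
Qed.

Lemma solution_continuous (F : R * R -> R * R) (phi : R -> R * R) :
  complete_solution F phi -> curve_continuous phi.
Proof.
intros H s; split.
- apply (ex_derive_continuous (fun s => fst (phi s))).
  eexists; apply derive_fst, H.
- apply (ex_derive_continuous (fun s => snd (phi s))).
  eexists; apply derive_snd, H.
Qed.

Lemma rad_continuous (X : R -> R * R) (s : R) :
  curve_continuous X -> continuous (fun s => rad (X s)) s.
Proof.
intros HX; unfold rad.
apply (continuous_comp (fun s => fst (X s) * fst (X s) + snd (X s) * snd (X s)) sqrt).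
- apply @continuous_plus; apply @continuous_mult; apply HX.
- apply continuity_pt_filterlim, continuity_pt_sqrt; nra.
Qed.

Lemma derive_norm (x y : R -> R) (t dx dy : R) :
  is_derive x t dx -> is_derive y t dy -> 0 < x t * x t + y t * y t ->
  is_derive (fun s => sqrt (x s * x s + y s * y s)) t
    ((x t * dx + y t * dy) / sqrt (x t * x t + y t * y t)).
Proof.
intros Dx Dy Hp; auto_derive.
- repeat split; first [exact Hp | exists dx; exact Dx | exists dy; exact Dy].
- rewrite (Derive_eta _ _ _ Dx), (Derive_eta _ _ _ Dy).
  pose proof (sqrt_lt_R0 _ Hp); field; lra.
Qed.

(** By homogeneity the angular speed is r^N times a function of the angle alone;
    this decoupling is what makes the whole problem tractable. *)
Lemma polar_motion (lambda : R) (N : nat) (a b : nat -> R)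
    (phi : R -> R * R) (th : R -> R) (u v t : R) :
  complete_solution (field lambda (S N) a b) phi ->
  (forall s, u <= s <= v -> phi s <> (0, 0)) ->
  angle_lift phi th u v -> u < t < v ->
  is_derive th t (rad (phi t) ^ N * angular (S N) a b (th t)) /\
  is_derive (fun s => rad (phi s)) t
    (lambda * rad (phi t) + rad (phi t) ^ S N * radial (S N) a b (th t)).
Proof.
intros Hphi Hnz L Ht.
assert (Dx := derive_fst _ _ _ (Hphi t)).
assert (Dy := derive_snd _ _ _ (Hphi t)).
assert (Nt := Hnz t ltac:(lra)).
assert (Hr := rad_pos _ Nt).
assert (Et := proj2 L t ltac:(lra)).
assert (H1 := cos_sin_sq (th t)).
assert (Ex : fst (phi t) = rad (phi t) * cos (th t)) by (rewrite Et at 1; reflexivity).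
assert (Ey : snd (phi t) = rad (phi t) * sin (th t)) by (rewrite Et at 1; reflexivity).
assert (Fx : fst (field lambda (S N) a b (phi t)) = lambda * (rad (phi t) * cos (th t))
  + rad (phi t) ^ S N *
    (radial (S N) a b (th t) * cos (th t) - angular (S N) a b (th t) * sin (th t))).
{ unfold field; simpl fst; rewrite Ex; f_equal.
  rewrite Et at 1; apply form_frame_fst. }
assert (Fy : snd (field lambda (S N) a b (phi t)) = lambda * (rad (phi t) * sin (th t))
  + rad (phi t) ^ S N *
    (radial (S N) a b (th t) * sin (th t) + angular (S N) a b (th t) * cos (th t))).
{ unfold field; simpl snd; rewrite Ey; f_equal.
  rewrite Et at 1; apply form_frame_snd. }
rewrite Fx in Dx; rewrite Fy in Dy.
set (r := rad (phi t)) in *; set (f := radial (S N) a b (th t)) in *;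
set (g := angular (S N) a b (th t)) in *.
split.
- replace (r ^ N * g) with ((fst (phi t) * (lambda * (r * sin (th t))
     + r ^ S N * (f * sin (th t) + g * cos (th t)))
     - snd (phi t) * (lambda * (r * cos (th t))
     + r ^ S N * (f * cos (th t) - g * sin (th t)))) / (r * r)).
  + apply (angle_lift_derive phi th u v); try assumption.
    now apply solution_continuous with (field lambda (S N) a b).
  + rewrite Ex, Ey.
    transitivity (r ^ N * g * (cos (th t) * cos (th t) + sin (th t) * sin (th t)));
      [simpl; field; lra | rewrite H1; ring].
- replace (lambda * r + r ^ S N * f) with ((fst (phi t) * (lambda * (r * cos (th t))
     + r ^ S N * (f * cos (th t) - g * sin (th t)))
     + snd (phi t) * (lambda * (r * sin (th t))
     + r ^ S N * (f * sin (th t) + g * cos (th t)))) / r).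
  + exact (derive_norm _ _ t _ _ Dx Dy (sqr_sum_pos _ Nt)).
  + rewrite Ex, Ey.
    transitivity ((lambda * r + r ^ S N * f) *
      (cos (th t) * cos (th t) + sin (th t) * sin (th t)));
      [simpl; field; lra | rewrite H1; ring].
Qed.

(** * Points of an invariant closed curve on invariant rays *)

Lemma derive_neg_left (f : R -> R) (x l d : R) :
  is_derive f x l -> l < 0 -> 0 < d -> exists y, x - d < y < x /\ f x < f y.
Proof.
intros D Hl Hd; apply is_derive_Reals in D.
destruct (D (- l)) as [e He]; [lra |].
pose proof (cond_pos e) as Hep.
pose (h := - (Rmin d e / 2)).
assert (Hm : 0 < Rmin d e) by (apply Rmin_pos; assumption).
assert (Hm1 := Rmin_l d e); assert (Hm2 := Rmin_r d e).
exists (x + h); split; [unfold h; lra |].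
specialize (He h ltac:(unfold h; lra)).
assert (Hh : Rabs h < e) by (unfold h; rewrite Rabs_Ropp, Rabs_right; lra).
specialize (He Hh); apply Rabs_def2 in He.
assert (Q : (f (x + h) - f x) / h < 0) by lra.
assert (Hh0 : h < 0) by (unfold h; lra).
assert (E : f (x + h) - f x = (f (x + h) - f x) / h * h) by (field; lra).
assert (0 < (f (x + h) - f x) / h * h); [| lra].
nra.
Qed.

Lemma first_crossing (f : R -> R) (p q tau : R) :
  (forall s, continuous f s) -> p < q -> f p < tau < f q ->
  exists s, p < s < q /\ f s = tau /\ forall s', p <= s' < s -> f s' < tau.
Proof.
intros Hf Hpq Htau.
pose (E := fun s => p <= s <= q /\ forall s', p <= s' <= s -> f s' < tau).
destruct (completeness E) as [m [Hm1 Hm2]].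
- exists q; intros s [Hs _]; lra.
- exists p; split; [lra |]; intros s' Hs'; replace s' with p by lra; lra.
- assert (Hpm : p <= m).
  { apply Hm1; split; [lra |]; intros s' Hs'; replace s' with p by lra; lra. }
  assert (Hmq : m <= q) by (apply Hm2; intros s [Hs _]; lra).
  assert (Hbelow : forall s, p <= s < m -> f s < tau).
  { intros s Hs; apply Rnot_le_lt; intros Hle.
    assert (m <= s); [| lra].
    apply Hm2; intros x [Hx Hx']; apply Rnot_lt_le; intros Hlt.
    specialize (Hx' s ltac:(lra)); lra. }
  assert (Em : f m = tau).
  { destruct (Rtotal_order (f m) tau) as [H | [H | H]]; [| exact H |]; exfalso.
    - destruct (continuous_eps f m (Hf m) (tau - f m)) as [d [Hd Hnear]]; [lra |].
      assert (m <> q) by (intros ->; lra).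
      pose (y := Rmin q (m + d / 2)).
      assert (Hy1 : y <= q) by apply Rmin_l.
      assert (Hy2 : y <= m + d / 2) by apply Rmin_r.
      assert (Hy3 : m < y) by (apply Rmin_glb_lt; lra).
      assert (y <= m); [| lra].
      apply Hm1; split; [lra |].
      intros s' Hs'; destruct (Rlt_le_dec s' m); [apply Hbelow; lra |].
      assert (B := Hnear s' ltac:(apply Rabs_def1; lra)).
      apply Rabs_def2 in B; lra.
    - destruct (continuous_eps f m (Hf m) (f m - tau)) as [d [Hd Hnear]]; [lra |].
      assert (m <> p) by (intros ->; lra).
      pose (y := Rmax p (m - d / 2)).
      assert (Hy1 : p <= y) by apply Rmax_l.
      assert (Hy2 : m - d / 2 <= y) by apply Rmax_r.
      assert (Hy3 : y < m) by (apply Rmax_lub_lt; lra).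
      assert (B := Hnear y ltac:(apply Rabs_def1; lra)).
      apply Rabs_def2 in B; specialize (Hbelow y ltac:(lra)); lra. }
  exists m; repeat split; try assumption.
  + destruct Hpm as [| <-]; [assumption | lra].
  + destruct Hmq as [| ->]; [assumption | lra].
Qed.

(** Reduction of both parameters to [0, 1), where the curve is injective. *)
Lemma simple_closed_fiber (c : R -> R * R) (s s' : R) :
  simple_closed c -> c s = c s' -> exists j : Z, s = s' + IZR j * 1.
Proof.
intros [_ [Hper Hinj]] E.
destruct (period_representative 1 0 s) as [i Hi]; [lra |].
destruct (period_representative 1 0 s') as [j Hj]; [lra |].
exists (j - i)%Z; rewrite minus_IZR.
assert (s + IZR i * 1 = s' + IZR j * 1); [| lra].
apply Hinj; try lra.
rewrite !(period_iterate_curve c 1 Hper); exact E.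
Qed.

Lemma image_fundamental (c : R -> R * R) (p : R * R) :
  simple_closed c -> image c p -> exists s, 0 <= s < 1 /\ c s = p.
Proof.
intros [_ [Hper _]] [s <-].
destruct (period_representative 1 0 s) as [i Hi]; [lra |].
exists (s + IZR i * 1); split; [lra | apply (period_iterate_curve c 1 Hper)].
Qed.

Lemma rad_bounds_on_curve (c : R -> R * R) :
  simple_closed c -> ~ image c (0, 0) ->
  exists M, 0 < M /\ forall p, image c p -> 0 < rad p /\ rad p <= M /\ / rad p <= M.
Proof.
intros Hc Hnz.
assert (HC := curve_continuous_of_continuous c (proj1 Hc)).
assert (Hpos : forall s, 0 < rad (c s)).
{ intros s; apply rad_pos; intros E; apply Hnz; exists s; exact E. }
destruct (continuous_bounded (fun s => rad (c s)) 0 1) as [M1 [HM1 B1]].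
{ intros s _; now apply rad_continuous. }
destruct (continuous_bounded (fun s => / rad (c s)) 0 1) as [M2 [HM2 B2]].
{ intros s _; apply continuous_Rinv_comp; [now apply rad_continuous |].
  specialize (Hpos s); lra. }
exists (M1 + M2); split; [lra |].
intros p Hp; destruct (image_fundamental c p Hc Hp) as [s [Hs <-]].
specialize (B1 s ltac:(lra)); specialize (B2 s ltac:(lra)); specialize (Hpos s).
repeat split; lra.
Qed.

Lemma derive_inverse_power (r : R -> R) (N : nat) (t dr : R) :
  is_derive r t dr -> 0 < r t ->
  is_derive (fun s => / r s ^ N) t (- INR N * dr / r t ^ S N).
Proof.
intros D Hr.
assert (HN : forall k, 0 < r t ^ k) by (intros k; now apply pow_lt).
auto_derive.
- repeat split; [exists dr; exact D | specialize (HN N); lra].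
- rewrite (Derive_eta _ _ _ D).
  destruct N as [|N]; [simpl; field; lra |].
  change (Init.Nat.pred (S N)) with N; pose proof (HN N); simpl (r t ^ _); field; lra.
Qed.

Lemma derive_exp_weighted (u : R -> R) (t du p q k C : R) :
  is_derive u t du ->
  is_derive (fun s => (p * u s + q) * exp (k * s) - C) t
    ((p * du + k * (p * u t + q)) * exp (k * t)).
Proof.
intros D; auto_derive; [repeat split; exists du; exact D |].
rewrite (Derive_eta _ _ _ D); ring.
Qed.

(** On a ray where the angular component vanishes, r^(-N) satisfies a linear
    equation with constant coefficients; its only solution bounded on the whole
    line is the equilibrium.  Since the curve is bounded away from the origin
    and from infinity, it meets such a ray at an equilibrium only. *)
Lemma equilibrium_on_invariant_ray (lambda : R) (N : nat) (a b : nat -> R)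
    (c : R -> R * R) (r0 th0 : R) :
  lambda <> 0 -> (0 < N)%nat -> simple_closed c ->
  flow_invariant (field lambda (S N) a b) (image c) -> ~ image c (0, 0) ->
  0 < r0 -> image c (polar r0 th0) -> angular (S N) a b th0 = 0 ->
  lambda + r0 ^ N * radial (S N) a b th0 = 0.
Proof.
intros Hl HN Hc Hinv Hnz Hr0 Hp Hg.
set (f0 := radial (S N) a b th0).
destruct (rad_bounds_on_curve c Hc Hnz) as [M [HM HB]].
destruct (Hinv _ Hp) as [phi [Hphi [Hphi0 HphiC]]].
assert (Hphinz : forall t, phi t <> (0, 0)).
{ intros t E; apply Hnz; rewrite <- E; apply HphiC. }
destruct (angular_lip (S N) a b) as [K [HK HLip]].
pose (B := Rabs lambda * M ^ N + Rabs f0).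
assert (HMN : 0 < M ^ N) by now apply pow_lt.
assert (HB0 : 0 <= B).
{ unfold B; pose proof (Rabs_pos lambda); pose proof (Rabs_pos f0); nra. }
assert (key : forall T, 0 < T -> Rabs (lambda / r0 ^ N + f0) * (1 + T) <= B).
{ intros T HT.
  pose (w := - (T / lambda)).
  pose (W := Rabs w + 1).
  assert (Hw : - W < w < W).
  { unfold W; pose proof (Rle_abs w); pose proof (Rle_abs (- w)).
    rewrite Rabs_Ropp in *; lra. }
  assert (HW : 0 < W) by (unfold W; pose proof (Rabs_pos w); lra).
  (* at the time w = - T / lambda the weight exp (N lambda w) is exp (- N T) *)
  destruct (angle_lift_exists phi (- W) W) as [th L].
  { now apply solution_continuous with (field lambda (S N) a b). }
  { exact Hphinz. }
  { lra. }
  assert (Hbetween : forall t, Rmin 0 w <= t <= Rmax 0 w -> - W < t < W).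
  { intros t; unfold Rmin, Rmax; destruct (Rle_dec 0 w); lra. }
  assert (Hmot : forall t, - W < t < W -> _)
    by (intros t Ht; exact (polar_motion lambda N a b phi th (- W) W t Hphi
                              (fun s _ => Hphinz s) L Ht)).
  cbv beta in Hmot.
  assert (E0 : rad (phi 0) = r0) by (rewrite Hphi0; apply rad_polar; lra).
  destruct (polar_same_angle r0 r0 th0 (th 0) Hr0 Hr0) as [j Hj].
  { rewrite <- Hphi0, <- E0; apply (proj2 L); lra. }
  (* the trajectory stays on the ray: Gronwall for the angle, as the angular
     component is Lipschitz and vanishes at th 0 *)
  assert (Hth : forall t, Rmin 0 w <= t <= Rmax 0 w -> th t = th 0).
  { intros t Ht.
    assert (G : th t - th 0 = 0); [| lra].
    apply (gronwall_zero (fun s => th s - th 0)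
      (fun s => rad (phi s) ^ N * angular (S N) a b (th s)) (M ^ N * K) 0 t);
      [| lra].
    intros s Hs.
    assert (Hs' : - W < s < W).
    { apply Hbetween; revert Hs Ht; unfold Rmin, Rmax.
      destruct (Rle_dec 0 w), (Rle_dec 0 t); lra. }
    split.
    - replace (rad (phi s) ^ N * angular (S N) a b (th s))
        with (minus (rad (phi s) ^ N * angular (S N) a b (th s)) 0)
        by (unfold minus, plus, opp; simpl; ring).
      apply @is_derive_minus; [apply (Hmot s Hs') | apply @is_derive_const].
    - rewrite Rabs_mult, Rmult_assoc.
      destruct (HB _ (HphiC s)) as [P1 [P2 _]].
      apply Rmult_le_compat; try apply Rabs_pos.
      + rewrite Rabs_right by (apply Rle_ge, pow_le; lra).
        apply pow_incr; lra.
      + destruct (HLip (th s) (th 0)) as [_ P3].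
        rewrite Hj, angular_period, Hg, Rminus_0_r, <- Hj in P3; exact P3. }
  pose (z := fun t => (lambda * / rad (phi t) ^ N + f0) * exp (INR N * lambda * t)).
  assert (Hz : z w = z 0).
  { assert (G : z w - z 0 = 0); [| lra].
    apply (gronwall_zero (fun s => z s - z 0) (fun _ => 0) 0 0 w); [| lra].
    intros s Hs; split; [| rewrite Rabs_R0; lra].
    assert (Dr := proj2 (Hmot s (Hbetween s Hs))).
    rewrite (Hth s Hs), Hj, radial_period in Dr; fold f0 in Dr.
    assert (Pr : 0 < rad (phi s)) by apply (HB _ (HphiC s)).
    assert (Du := derive_inverse_power (fun s => rad (phi s)) N s _ Dr Pr).
    assert (HrsN : 0 < rad (phi s) ^ N) by now apply pow_lt.
    assert (Dz := derive_exp_weighted (fun s => / rad (phi s) ^ N) s _ lambda f0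
      (INR N * lambda) (z 0) Du).
    cbv beta in Dz.
    replace ((lambda * (- INR N * (lambda * rad (phi s) + rad (phi s) ^ S N * f0)
        / rad (phi s) ^ S N) + INR N * lambda * (lambda * / rad (phi s) ^ N + f0))
        * exp (INR N * lambda * s)) with 0 in Dz
      by (simpl (rad (phi s) ^ S N); field; split; lra).
    exact Dz. }
  unfold z in Hz; rewrite Rmult_0_r, exp_0, Rmult_1_r, E0 in Hz.
  fold (lambda / r0 ^ N) in Hz.
  replace (INR N * lambda * w) with (- (INR N * T)) in Hz
    by (unfold w; field; exact Hl).
  rewrite exp_Ropp in Hz.
  assert (HNT : 1 + T <= exp (INR N * T)).
  { apply Rle_trans with (1 + INR N * T); [| apply exp_ineq1_le].
    assert (1 <= INR N) by (apply (le_INR 1); lia); nra. }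
  pose proof (exp_pos (INR N * T)) as He.
  apply Rle_trans with (Rabs (lambda / r0 ^ N + f0) * exp (INR N * T)).
  { apply Rmult_le_compat_l; [apply Rabs_pos | exact HNT]. }
  rewrite <- Hz, Rabs_mult, Rabs_inv, (Rabs_right (exp _)), Rmult_assoc, Rinv_l,
    Rmult_1_r by lra.
  apply Rle_trans with (1 := Rabs_triang _ _); unfold B.
  apply Rplus_le_compat_r; rewrite Rabs_mult.
  apply Rmult_le_compat_l; [apply Rabs_pos |].
  destruct (HB _ (HphiC w)) as [P1 [_ P3]].
  rewrite <- pow_inv, <- RPow_abs, Rabs_inv, (Rabs_right (rad _)) by lra.
  apply pow_incr; split; [left; apply Rinv_0_lt_compat |]; lra. }
assert (HrN : 0 < r0 ^ N) by now apply pow_lt.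
assert (Z : lambda / r0 ^ N + f0 = 0).
{ destruct (Req_dec (lambda / r0 ^ N + f0) 0) as [|Hne]; [assumption | exfalso].
  pose proof (Rabs_pos_lt _ Hne) as Hpos.
  set (A := Rabs (lambda / r0 ^ N + f0)) in *.
  specialize (key ((B + 1) / A) ltac:(apply Rdiv_lt_0_compat; lra)).
  replace (A * (1 + (B + 1) / A)) with (A + (B + 1)) in key by (field; lra).
  lra. }
transitivity (r0 ^ N * (lambda / r0 ^ N + f0)); [field; lra | rewrite Z; ring].
Qed.

(** * Angular structure of a heteroclinic cycle *)

(** The trajectory through c s' runs along c forwards, so just before time 0 it
    is on the arc that ends at s'.  If sigma times the angular component were
    negative, sigma alpha would decrease along the trajectory and be larger there
    than at s'. *)
Lemma angle_moves_forward (lambda : R) (N : nat) (a b : nat -> R)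
    (c : R -> R * R) (alpha : R -> R) (sigma p s' : R) :
  simple_closed c ->
  flow_invariant (field lambda (S N) a b) (image c) -> ~ image c (0, 0) ->
  (forall phi, nonequilibrium_trajectory_in (field lambda (S N) a b) (image c) phi ->
     runs_along c phi) ->
  angle_lift c alpha (-1) 2 ->
  0 <= p < s' -> s' <= 1 ->
  (forall s, p <= s < s' -> sigma * alpha s < sigma * alpha s') ->
  0 <= sigma * angular (S N) a b (alpha s').
Proof.
intros Hc Hinv Hnz Hor L Hp Hs' Hbelow.
apply Rnot_lt_le; intros Hneg.
assert (Hcnz : forall s, c s <> (0, 0)).
{ intros s E; apply Hnz; exists s; exact E. }
destruct (Hinv (c s')) as [phi [Hphi [Hphi0 HphiC]]]; [exists s'; reflexivity |].
assert (Hphinz : forall t, phi t <> (0, 0)).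
{ intros t E; apply Hnz; rewrite <- E; apply HphiC. }
destruct (Hor phi) as [run [Crun [Hinc Hrun]]].
{ split; [exact Hphi | split; [exact HphiC |]].
  rewrite Hphi0, (proj2 L s') by lra.
  rewrite equilibrium_polar by (apply rad_pos, Hcnz).
  intros [_ E]; rewrite E in Hneg; lra. }
(* the lift of the trajectory is translated to start at s' itself *)
destruct (simple_closed_fiber c (run 0) s' Hc) as [j Hj].
{ rewrite <- Hrun; exact Hphi0. }
pose (pos := fun t => run t - IZR j * 1).
assert (Hpos0 : pos 0 = s') by (unfold pos; lra).
assert (Hcpos : forall t, phi t = c (pos t)).
{ intros t; rewrite Hrun.
  rewrite <- (period_iterate_curve c 1 (proj1 (proj2 Hc)) j (pos t)).
  f_equal; unfold pos; ring. }
assert (Cpos : forall t, continuous pos t).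
{ intros t; apply @continuous_minus; [apply Crun | apply continuous_const]. }
destruct (continuous_eps pos 0 (Cpos 0) (Rmin (s' - p) 1)) as [d [Hd Hnear]].
{ apply Rmin_pos; lra. }
assert (Hnear' : forall t, - d < t < d -> p < pos t < s' + 1 /\ -1 < pos t).
{ intros t Ht; specialize (Hnear t ltac:(apply Rabs_def1; lra)).
  rewrite Hpos0 in Hnear; apply Rabs_def2 in Hnear.
  pose proof (Rmin_l (s' - p) 1); pose proof (Rmin_r (s' - p) 1); lra. }
assert (Lphi : angle_lift phi (fun t => alpha (pos t)) (- (d / 2)) (d / 2)).
{ split.
  - intros t; apply (continuous_comp pos alpha); [apply Cpos | apply L].
  - intros t Ht; destruct (Hnear' t ltac:(lra)).
    rewrite Hcpos; apply L; lra. }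
destruct (polar_motion lambda N a b phi _ _ _ 0 Hphi (fun s _ => Hphinz s) Lphi)
  as [D _]; [lra |].
cbv beta in D; rewrite Hpos0 in D.
destruct (derive_neg_left (fun t => sigma * alpha (pos t)) 0
  (sigma * (rad (phi 0) ^ N * angular (S N) a b (alpha s'))) (d / 2))
  as [t [Ht1 Ht2]].
- exact (is_derive_scal (fun t => alpha (pos t)) 0 sigma _ D).
- assert (0 < rad (phi 0) ^ N) by apply pow_lt, rad_pos, Hphinz.
  nra.
- lra.
- rewrite Hpos0 in Ht2.
  assert (pos t < s') by (rewrite <- Hpos0; unfold pos; specialize (Hinc t 0); lra).
  destruct (Hnear' t ltac:(lra)).
  specialize (Hbelow (pos t) ltac:(lra)); lra.
Qed.

(** With sigma = 1 the angle passes tau upwards between p and q, with sigma = -1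
    downwards; the first passage satisfies the hypothesis of the previous
    lemma. *)
Lemma crossing_sign (lambda : R) (N : nat) (a b : nat -> R)
    (c : R -> R * R) (alpha : R -> R) (sigma p q tau : R) :
  simple_closed c ->
  flow_invariant (field lambda (S N) a b) (image c) -> ~ image c (0, 0) ->
  (forall phi, nonequilibrium_trajectory_in (field lambda (S N) a b) (image c) phi ->
     runs_along c phi) ->
  angle_lift c alpha (-1) 2 ->
  sigma <> 0 -> 0 <= p < q -> q <= 1 ->
  sigma * alpha p < sigma * tau < sigma * alpha q ->
  exists s, p < s < q /\ alpha s = tau /\ 0 <= sigma * angular (S N) a b tau.
Proof.
intros Hc Hinv Hnz Hor L Hsg Hp Hq Htau.
destruct (first_crossing (fun s => sigma * alpha s) p q (sigma * tau))
  as [s [Hs [E Hbelow]]]; [| lra | exact Htau |].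
{ intros s; apply @continuous_mult; [apply continuous_const | apply L]. }
apply Rmult_eq_reg_l in E; [| exact Hsg].
exists s; split; [exact Hs | split; [exact E |]]; rewrite <- E.
apply (angle_moves_forward lambda N a b c alpha sigma p s); try assumption; try lra.
rewrite E; exact Hbelow.
Qed.

(** Since lambda is nonzero so is f, and r^N = - lambda / f. *)
Lemma same_ray_equilibria (lambda r r' f : R) (N : nat) :
  lambda <> 0 -> (0 < N)%nat -> 0 < r -> 0 < r' ->
  lambda + r ^ N * f = 0 -> lambda + r' ^ N * f = 0 -> r = r'.
Proof.
intros Hl HN Hr Hr' E E'.
assert (f <> 0) by (intros ->; lra).
apply (pow_inj_pos r r' N); try assumption.
apply Rmult_eq_reg_r with f; [lra | assumption].
Qed.

Lemma nonneg_of_fundamental_interval (g : R -> R) (P lo : R) :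
  0 < P -> (forall x, continuous g x) -> (forall x (j : Z), g (x + IZR j * P) = g x) ->
  (forall x, lo < x < lo + P -> 0 <= g x) -> forall x, 0 <= g x.
Proof.
intros HP Hg Hper Hin x.
destruct (period_representative P lo x HP) as [j Hj].
rewrite <- (Hper x j); set (y := x + IZR j * P) in *.
destruct (Rle_lt_or_eq_dec lo y (proj1 Hj)) as [Hlt | Heq]; [apply Hin; lra |].
apply Rnot_lt_le; intros Hneg.
destruct (continuous_eps g y (Hg y) (- g y)) as [d [Hd Hnear]]; [lra |].
assert (Hm : 0 < Rmin d P) by (apply Rmin_pos; lra).
pose proof (Rmin_l d P); pose proof (Rmin_r d P).
specialize (Hnear (y + Rmin d P / 2) ltac:(apply Rabs_def1; lra)).
specialize (Hin (y + Rmin d P / 2) ltac:(lra)).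
apply Rabs_def2 in Hnear; lra.
Qed.

(** The winding number k of the curve around the origin is nonzero.  Otherwise the
    angle, if not constant, would pass some value tau once upwards and once
    downwards, so that the angular component vanishes at tau by the two sign
    conditions; then both points are equilibria on one ray, hence equal, which
    contradicts simplicity.  If the angle were constant, the equilibrium on the
    curve would make every point of it an equilibrium on one ray.

    Since k is nonzero, every angle is passed in the direction of the sign of k,
    which fixes the sign of the angular component, and the curve meets every
    ray; on a ray where the angular component vanishes it does so at an
    equilibrium, and lambda + r^N f = 0 gives the sign of lambda f. *)
Lemma oriented_cycle_structure (lambda : R) (N : nat) (a b : nat -> R) (c : R -> R * R) :
  lambda <> 0 -> (0 < N)%nat -> polycycle (field lambda (S N) a b) c ->
  (forall phi, nonequilibrium_trajectory_in (field lambda (S N) a b) (image c) phi ->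
     runs_along c phi) ->
  (exists sigma, (sigma = 1 \/ sigma = -1) /\ forall th, 0 <= sigma * angular (S N) a b th) /\
  (exists th, angular (S N) a b th = 0) /\
  (forall th, angular (S N) a b th = 0 -> lambda * radial (S N) a b th < 0).
Proof.
intros Hl HN [Hc [Hinv [Hequi Hnz]]] Hor.
assert (Hcnz : forall s, c s <> (0, 0)).
{ intros s E; apply Hnz; exists s; exact E. }
destruct (angle_lift_exists c (-1) 2) as [alpha L].
{ apply curve_continuous_of_continuous, Hc. }
{ exact Hcnz. }
{ lra. }
set (g := angular (S N) a b); set (f := radial (S N) a b).
pose proof PI_RGT_0 as HPI.
assert (Hray : forall s, 0 <= s <= 1 -> g (alpha s) = 0 ->
  lambda + rad (c s) ^ N * f (alpha s) = 0).
{ intros s Hs Hg.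
  apply (equilibrium_on_invariant_ray lambda N a b c); try assumption.
  - apply rad_pos, Hcnz.
  - exists s; apply L; lra. }
assert (Hequi' : exists s, 0 <= s < 1 /\ g (alpha s) = 0).
{ destruct Hequi as [p [Hp Ep]].
  destruct (image_fundamental c p Hc Hp) as [s [Hs Es]].
  exists s; split; [exact Hs |].
  rewrite <- Es, (proj2 L s) in Ep by lra.
  apply equilibrium_polar in Ep; [apply Ep | apply rad_pos, Hcnz]. }
assert (Hinj : forall s s', 0 <= s < 1 -> 0 <= s' < 1 ->
  alpha s = alpha s' -> g (alpha s) = 0 -> s = s').
{ intros s s' Hs Hs' E Hg.
  apply Hc; try assumption.
  rewrite (proj2 L s), (proj2 L s'), E by lra; f_equal.
  apply (same_ray_equilibria lambda _ _ (f (alpha s)) N); try assumption;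
    try (apply rad_pos, Hcnz).
  - apply Hray; [lra | exact Hg].
  - rewrite E; apply Hray; [lra | rewrite <- E; exact Hg]. }
destruct (polar_same_angle (rad (c 0)) (rad (c 0)) (alpha 0) (alpha 1)) as [k Hk];
  try (apply rad_pos, Hcnz).
{ rewrite <- (proj2 L 0) by lra.
  rewrite <- (proj1 (proj2 Hc) 0), Rplus_0_l; apply L; lra. }
assert (Cross : forall sigma p q tau, sigma <> 0 -> 0 <= p < q -> q <= 1 ->
  sigma * alpha p < sigma * tau < sigma * alpha q ->
  exists s, p < s < q /\ alpha s = tau /\ 0 <= sigma * g tau).
{ intros; apply (crossing_sign lambda N a b c); assumption. }
assert (Hk0 : k <> 0%Z).
{ intros ->; rewrite Rmult_0_l, Rplus_0_r in Hk.
  destruct (classic (exists s, 0 <= s <= 1 /\ alpha s <> alpha 0))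
    as [[s [Hs Hne]] | Hconst].
  - assert (Hsg : exists sigma, sigma <> 0 /\ sigma * alpha 0 < sigma * alpha s).
    { destruct (Rtotal_order (alpha s) (alpha 0)) as [H | [H | H]]; [| easy |].
      - exists (-1); lra.
      - exists 1; lra. }
    destruct Hsg as [sigma [Hsg Hlt]].
    assert (s <> 0) by (intros ->; easy).
    assert (s <> 1) by (intros ->; congruence).
    set (tau := (alpha 0 + alpha s) / 2).
    destruct (Cross sigma 0 s tau) as [s1 [Hs1 [E1 G1]]]; try lra;
      [unfold tau; lra |].
    destruct (Cross (- sigma) s 1 tau) as [s2 [Hs2 [E2 G2]]]; try lra;
      [unfold tau; rewrite Hk; lra |].
    assert (Hg : g tau = 0).
    { assert (sigma * g tau = 0) by lra.
      destruct (Rmult_integral _ _ H1); [easy | assumption]. }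
    assert (s1 = s2); [| lra].
    apply Hinj; [lra | lra | lra | now rewrite E1].
  - assert (Hall : forall s, 0 <= s <= 1 -> alpha s = alpha 0).
    { intros s Hs; apply NNPP; intros Hne; apply Hconst.
      exists s; split; assumption. }
    destruct Hequi' as [s [Hs Hg]].
    assert (0 = 1 / 2); [| lra].
    apply Hinj; try lra.
    + rewrite (Hall (1 / 2)) by lra; reflexivity.
    + rewrite <- (Hall s) by lra; exact Hg. }
assert (Hwind : exists sigma lo, (sigma = 1 \/ sigma = -1) /\
  Rmin (alpha 0) (alpha 1) <= lo /\ lo + 2 * PI <= Rmax (alpha 0) (alpha 1) /\
  forall th, lo < th < lo + 2 * PI -> sigma * alpha 0 < sigma * th < sigma * alpha 1).
{ destruct (Z_lt_le_dec 0 k) as [Hpos | Hneg].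
  - assert (1 <= IZR k) by (apply IZR_le; lia).
    assert (2 * PI <= IZR k * (2 * PI)) by nra.
    exists 1, (alpha 0); rewrite Rmin_left, Rmax_right by lra.
    repeat split; try lra; now left.
  - assert (IZR k <= -1) by (apply IZR_le; lia).
    assert (IZR k * (2 * PI) <= - (2 * PI)) by nra.
    exists (-1), (alpha 0 - 2 * PI); rewrite Rmin_right, Rmax_left by lra.
    repeat split; try lra; now right. }
destruct Hwind as [sigma [lo [Hsg [Hlo [Hhi Hin]]]]].
split; [| split].
- exists sigma; split; [exact Hsg |].
  apply nonneg_of_fundamental_interval with (2 * PI) lo.
  + lra.
  + intros x; apply @continuous_mult; [apply continuous_const |].
    apply lip_continuous, angular_lip.
  + intros x j; unfold g; now rewrite angular_period.
  + intros th Hth.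
    destruct (Cross sigma 0 1 th) as [s [_ [_ H]]];
      [destruct Hsg; lra | lra | lra | now apply Hin | exact H].
- destruct Hequi' as [s [_ Hg]]; exists (alpha s); exact Hg.
- intros th Hg.
  destruct (period_representative (2 * PI) lo th) as [j Hj]; [lra |].
  destruct (IVT_gen alpha 0 1 (th + IZR j * (2 * PI))) as [s [Hs Es]].
  { intros s; apply continuity_pt_filterlim, L. }
  { lra. }
  rewrite Rmin_left, Rmax_right in Hs by lra.
  assert (Hgs : g (alpha s) = 0) by (rewrite Es; unfold g; now rewrite angular_period).
  specialize (Hray s Hs Hgs); rewrite Es in Hray.
  unfold f in Hray; rewrite radial_period in Hray.
  assert (HrN : 0 < rad (c s) ^ N) by apply pow_lt, rad_pos, Hcnz.
  assert (Hf : radial (S N) a b th <> 0) by (intros E; rewrite E in Hray; lra).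
  replace lambda with (- (rad (c s) ^ N * radial (S N) a b th)) by lra.
  assert (Hff : 0 < radial (S N) a b th * radial (S N) a b th) by nra.
  pose proof (Rmult_lt_0_compat _ _ HrN Hff); unfold f; lra.
Qed.

Lemma simple_closed_reverse (c : R -> R * R) :
  simple_closed c -> simple_closed (fun s => c (- s)).
Proof.
intros Hc; assert (Hc' := Hc); destruct Hc' as [C [P I]]; split; [| split].
- intros s; apply (continuous_comp (fun s => - s) c); [| apply C].
  apply (@continuous_opp _ R_AbsRing R_NormedModule (fun s => s)), continuous_id.
- intros s; rewrite <- (P (- (s + 1))); f_equal; ring.
- intros s s' Hs Hs' E.
  destruct (simple_closed_fiber c _ _ Hc E) as [j Hj].
  assert (-1 < IZR j < 1) by lra.
  assert (j = 0%Z) as ->.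
  { assert (-1 < j < 1)%Z by (split; apply lt_IZR; simpl; lra); lia. }
  lra.
Qed.

Lemma image_reverse (c : R -> R * R) (p : R * R) :
  image (fun s => c (- s)) p <-> image c p.
Proof.
split; intros [s <-]; [exists (- s); reflexivity |].
exists (- s); now rewrite Ropp_involutive.
Qed.

Lemma polycycle_reverse (F : R * R -> R * R) (c : R -> R * R) :
  polycycle F c -> polycycle F (fun s => c (- s)).
Proof.
intros [H1 [H2 [[p [Hp Ep]] H4]]]; split; [| split; [| split]].
- now apply simple_closed_reverse.
- intros q Hq; apply (proj1 (image_reverse c q)) in Hq.
  destruct (H2 q Hq) as [phi [A [B C]]]; exists phi.
  split; [exact A | split; [exact B |]]; intros t; apply (proj2 (image_reverse c _)), C.
- exists p; split; [now apply (proj2 (image_reverse c p)) | exact Ep].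
- now rewrite image_reverse.
Qed.

Lemma heteroclinic_structure (lambda : R) (N : nat) (a b : nat -> R) (c : R -> R * R) :
  lambda <> 0 -> (0 < N)%nat -> heteroclinic_cycle (field lambda (S N) a b) c ->
  (exists sigma, (sigma = 1 \/ sigma = -1) /\ forall th, 0 <= sigma * angular (S N) a b th) /\
  (exists th, angular (S N) a b th = 0) /\
  (forall th, angular (S N) a b th = 0 -> lambda * radial (S N) a b th < 0).
Proof.
intros Hl HN [Hp [Hor | Hor]].
- now apply oriented_cycle_structure with c.
- apply oriented_cycle_structure with (fun s => c (- s)); try assumption.
  + now apply polycycle_reverse.
  + intros phi [A [B C]]; apply Hor; split; [exact A | split; [| exact C]].
    intros t; apply (proj1 (image_reverse c _)), B.
Qed.

(** * The rotational perturbation *)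

Lemma form_times_fst (n : nat) (a : nat -> R) :
  exists a', forall p, form (S n) a' p = fst p * form n a p.
Proof.
exists (fun i => match i with O => 0 | S j => a j end); intros p; unfold form.
rewrite decomp_sum by lia; simpl pred; rewrite scal_sum.
rewrite !Rmult_0_l, Rplus_0_l; apply sum_eq; intros i Hi; simpl; ring.
Qed.

Lemma form_times_snd (n : nat) (a : nat -> R) :
  exists a', forall p, form (S n) a' p = snd p * form n a p.
Proof.
exists (fun i => if Nat.leb i n then a i else 0); intros p; unfold form.
rewrite tech5, scal_sum.
replace (Nat.leb (S n) n) with false by (symmetry; apply Nat.leb_gt; lia).
rewrite !Rmult_0_l, Rplus_0_r; apply sum_eq; intros i Hi.
replace (Nat.leb i n) with true by (symmetry; apply Nat.leb_le; lia).
replace (S n - i)%nat with (S (n - i)) by lia; simpl; ring.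
Qed.

Lemma form_plus_scaled (n : nat) (a d : nat -> R) (e : R) (p : R * R) :
  form n (fun i => a i + e * d i) p = form n a p + e * form n d p.
Proof.
unfold form; rewrite scal_sum, <- plus_sum; apply sum_eq; intros i _; ring.
Qed.

Lemma form_times_norm_sqr (n : nat) (a : nat -> R) :
  exists a', forall p,
    form (S (S n)) a' p = (fst p * fst p + snd p * snd p) * form n a p.
Proof.
destruct (form_times_fst n a) as [a1 H1], (form_times_fst (S n) a1) as [a2 H2].
destruct (form_times_snd n a) as [b1 G1], (form_times_snd (S n) b1) as [b2 G2].
exists (fun i => a2 i + 1 * b2 i); intros p.
rewrite form_plus_scaled, H2, H1, G2, G1; ring.
Qed.

(** The coefficients of the perturbing field r^(2m) (-y, x), chosen because it
    changes the angular component by a constant and the radial one not at all. *)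
Lemma rotation_forms (m : nat) :
  exists d e, forall p,
    form (S (2 * m)) d p = - snd p * (fst p * fst p + snd p * snd p) ^ m /\
    form (S (2 * m)) e p = fst p * (fst p * fst p + snd p * snd p) ^ m.
Proof.
induction m as [|m [d [e H]]].
- exists (fun i => match i with O => -1 | _ => 0 end),
    (fun i => match i with O => 0 | _ => 1 end).
  intros p; unfold form; simpl; split; ring.
- destruct (form_times_norm_sqr (S (2 * m)) d) as [d' Hd], (form_times_norm_sqr (S (2 * m)) e) as [e' He].
  exists d', e'; intros p.
  replace (2 * S m)%nat with (S (S (2 * m))) by lia.
  rewrite Hd, He, (proj1 (H p)), (proj2 (H p)); simpl; split; ring.
Qed.

Lemma radial_perturbed (m : nat) (a b d e : nat -> R) (eps th : R) :
  (forall p,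
    form (S (2 * m)) d p = - snd p * (fst p * fst p + snd p * snd p) ^ m /\
    form (S (2 * m)) e p = fst p * (fst p * fst p + snd p * snd p) ^ m) ->
  radial (S (2 * m)) (fun i => a i + eps * d i) (fun i => b i + eps * e i) th
  = radial (S (2 * m)) a b th.
Proof.
intros H; unfold radial; rewrite !form_plus_scaled.
rewrite (proj1 (H _)), (proj2 (H _)); simpl fst; simpl snd; ring.
Qed.

Lemma angular_perturbed (m : nat) (a b d e : nat -> R) (eps th : R) :
  (forall p,
    form (S (2 * m)) d p = - snd p * (fst p * fst p + snd p * snd p) ^ m /\
    form (S (2 * m)) e p = fst p * (fst p * fst p + snd p * snd p) ^ m) ->
  angular (S (2 * m)) (fun i => a i + eps * d i) (fun i => b i + eps * e i) th
  = angular (S (2 * m)) a b th + eps.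
Proof.
intros H; unfold angular; rewrite !form_plus_scaled.
rewrite (proj1 (H _)), (proj2 (H _)); simpl fst; simpl snd.
rewrite cos_sin_sq, pow1.
transitivity (cos th * form (S (2 * m)) b (cos th, sin th)
  - sin th * form (S (2 * m)) a (cos th, sin th)
  + eps * (cos th * cos th + sin th * sin th)); [ring | rewrite cos_sin_sq; ring].
Qed.

Lemma form_circle_antipode (n : nat) (a : nat -> R) (th : R) :
  form n a (cos (th + PI), sin (th + PI)) = (-1) ^ n * form n a (cos th, sin th).
Proof.
rewrite <- form_homogeneous; f_equal.
rewrite neg_cos, neg_sin; f_equal; ring.
Qed.

(** In even degree the antipode of th0 is also a zero of the angular component,
    and the radial component has the opposite sign there. *)
Lemma degree_odd (lambda : R) (n : nat) (a b : nat -> R) (th0 : R) :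
  angular n a b th0 = 0 ->
  (forall th, angular n a b th = 0 -> lambda * radial n a b th < 0) ->
  exists m, n = S (2 * m).
Proof.
intros Hg Hf.
destruct (Nat.Even_or_Odd n) as [[m Em] | [m Em]]; [exfalso | exists m; lia].
assert (E1 : (-1) ^ n = 1) by (rewrite Em; apply pow_1_even).
assert (Hf0 := Hf _ Hg).
specialize (Hf (th0 + PI)).
unfold radial, angular in *.
rewrite !form_circle_antipode, E1, neg_cos, neg_sin in Hf.
specialize (Hf ltac:(lra)); lra.
Qed.

(** Away from the zeros of G the quotient is bounded above independently of eps,
    by a constant M with h <= M G.  To the right of the zero th0 the numerator is
    at most - eta and the denominator at most K s + eps, which contributes
    - (eta / K) ln ((K d + eps) / eps): this tends to minus infinity. *)
Lemma negative_over_angular_speed (h G : R -> R) (P th0 : R) :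
  0 < P -> lip h -> lip G -> (forall x, 0 <= G x) -> G th0 = 0 ->
  (forall x, G x = 0 -> h x < 0) ->
  exists eps0, 0 < eps0 /\ forall eps, 0 < eps < eps0 ->
    RInt (fun x => h x / (G x + eps)) th0 (th0 + P) < 0.
Proof.
intros HP Hh HG G0 Gth0 Hneg.
assert (CG : forall x, continuous G x) by (intros; now apply lip_continuous).
assert (Ch : forall x, continuous h x) by (intros; now apply lip_continuous).
(* where G > 0 a local constant does, where G = 0 the numerator is negative *)
assert (HM : exists M, 0 <= M /\ forall x, th0 <= x <= th0 + P -> h x <= M * G x).
{ apply (interval_induction (fun u v =>
    exists M, 0 <= M /\ forall x, u <= x <= v -> h x <= M * G x)); [| | lra].
  - intros u v w _ _ [M1 [P1 H1]] [M2 [P2 H2]]; exists (M1 + M2); split; [lra |].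
    intros x Hx; specialize (G0 x); destruct (Rle_lt_dec x v).
    + specialize (H1 x ltac:(lra)); nra.
    + specialize (H2 x ltac:(lra)); nra.
  - intros x; destruct (Rle_lt_or_eq_dec 0 (G x) (G0 x)) as [Hpos | Hz].
    + destruct (continuous_eps G x (CG x) (G x / 2)) as [d [Hd H]]; [lra |].
      destruct Hh as [K [HK Hh]].
      exists d; split; [exact Hd |]; intros u v Hu Huv Hv.
      exists (K / (G x / 2)); split.
      { apply Rmult_le_pos; [lra | left; apply Rinv_0_lt_compat; lra]. }
      intros y Hy; specialize (H y ltac:(apply Rabs_def1; lra)); apply Rabs_def2 in H.
      apply Rle_trans with K.
      { apply Rle_trans with (1 := Rle_abs _), (Hh y y). }
      replace K with (K / (G x / 2) * (G x / 2)) at 1 by (field; lra).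
      apply Rmult_le_compat_l; [| lra].
      apply Rmult_le_pos; [lra | left; apply Rinv_0_lt_compat; lra].
    + destruct (continuous_pos_near (fun y => - h y) x) as [d [Hd H]].
      { apply @continuous_opp, Ch. }
      { symmetry in Hz; specialize (Hneg x Hz); lra. }
      exists d; split; [exact Hd |]; intros u v Hu Huv Hv.
      exists 0; split; [lra |]; intros y Hy.
      specialize (H y ltac:(apply Rabs_def1; lra)); lra. }
destruct HM as [M [HM HMG]].
destruct HG as [K0 [HK0 HG]].
pose (K := K0 + 1).
assert (HK : 0 < K) by (unfold K; lra).
assert (HGK : forall x, th0 <= x -> G x <= K * (x - th0)).
{ intros x Hx; destruct (HG x th0) as [_ H].
  rewrite Gth0, Rminus_0_r, (Rabs_right (x - th0)) in H by lra.
  pose proof (Rle_abs (G x)); unfold K; nra. }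
pose (eta := - h th0 / 2).
assert (Heta : 0 < eta) by (unfold eta; specialize (Hneg th0 Gth0); lra).
destruct (continuous_eps h th0 (Ch th0) eta Heta) as [d0 [Hd0 Hnear]].
pose (d := Rmin d0 P / 2).
assert (Hm : 0 < Rmin d0 P) by (apply Rmin_pos; lra).
pose proof (Rmin_l d0 P) as Hm1; pose proof (Rmin_r d0 P) as Hm2.
assert (Hd : 0 < d < P) by (unfold d; lra).
assert (Hhd : forall x, th0 <= x <= th0 + d -> h x <= - eta).
{ intros x Hx; specialize (Hnear x ltac:(apply Rabs_def1; unfold d in Hx; lra)).
  apply Rabs_def2 in Hnear; unfold eta in *; lra. }
(* eps0 solves (eta / K) (ln (K d) - ln eps0) = M P *)
exists (K * d * exp (- (M * P * K / eta))); split.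
{ apply Rmult_lt_0_compat; [nra | apply exp_pos]. }
intros eps [He1 He2].
assert (Hden : forall x, 0 < G x + eps) by (intros x; specialize (G0 x); lra).
assert (Cq : forall x, continuous (fun x => h x / (G x + eps)) x).
{ intros x; apply @continuous_mult; [apply Ch |].
  apply continuous_Rinv_comp; [| specialize (Hden x); lra].
  apply @continuous_plus; [apply CG | apply continuous_const]. }
assert (Iq : forall u v, ex_RInt (fun x => h x / (G x + eps)) u v).
{ intros u v; apply (ex_RInt_continuous (V := R_CompleteNormedModule)).
  intros x _; apply Cq. }
rewrite <- (RInt_Chasles _ th0 (th0 + d) (th0 + P) (Iq _ _) (Iq _ _)).
assert (I2 : RInt (fun x => h x / (G x + eps)) (th0 + d) (th0 + P) <= M * P).
{ apply Rle_trans with (RInt (fun _ => M) (th0 + d) (th0 + P)).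
  - apply RInt_le; [lra | apply Iq | apply ex_RInt_const |].
    intros x Hx; specialize (Hden x); specialize (HMG x ltac:(lra)).
    apply Rmult_le_reg_r with (G x + eps); [exact Hden |].
    replace (h x / (G x + eps) * (G x + eps)) with (h x) by (field; lra).
    apply Rle_trans with (1 := HMG); apply Rmult_le_compat_l; lra.
  - rewrite RInt_const; unfold scal; simpl; unfold mult; simpl; nra. }
assert (DL : forall x, th0 <= x ->
  is_derive (fun x => - (eta / K) * ln (K * (x - th0) + eps)) x
    (- (eta / (K * (x - th0) + eps)))).
{ intros x Hx; assert (0 < K * (x - th0) + eps) by nra.
  auto_derive; [assumption | field; split; lra]. }
assert (IL : is_RInt (fun x => - (eta / (K * (x - th0) + eps))) th0 (th0 + d)
  (- (eta / K) * ln (K * d + eps) - - (eta / K) * ln eps)).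
{ replace (ln (K * d + eps)) with (ln (K * (th0 + d - th0) + eps)) by (f_equal; ring).
  replace (ln eps) with (ln (K * (th0 - th0) + eps)) by (f_equal; ring).
  apply (is_RInt_derive (fun x => - (eta / K) * ln (K * (x - th0) + eps))).
  - intros x; rewrite Rmin_left, Rmax_right by lra; intros Hx; apply DL; lra.
  - intros x; rewrite Rmin_left, Rmax_right by lra; intros Hx.
    apply (ex_derive_continuous (fun x => - (eta / (K * (x - th0) + eps)))).
    assert (0 < K * (x - th0) + eps) by nra.
    auto_derive; lra. }
assert (I1 : RInt (fun x => h x / (G x + eps)) th0 (th0 + d)
  <= - (eta / K) * ln (K * d + eps) - - (eta / K) * ln eps).
{ rewrite <- (is_RInt_unique _ _ _ _ IL).
  apply RInt_le; [lra | apply Iq | eexists; exact IL |].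
  intros x Hx; specialize (Hden x).
  specialize (HGK x ltac:(lra)); specialize (Hhd x ltac:(lra)).
  apply Rle_trans with (- eta / (G x + eps)).
  - apply Rmult_le_compat_r; [left; apply Rinv_0_lt_compat |]; lra.
  - replace (- eta / (G x + eps)) with (- (eta / (G x + eps))) by (field; lra).
    apply Ropp_le_contravar, Rmult_le_compat_l; [lra |].
    apply Rinv_le_contravar; lra. }
assert (HKd : 0 < K * d) by nra.
assert (L1 : ln (K * d) <= ln (K * d + eps)) by (apply Rcomplements.ln_le; lra).
assert (L2 : ln eps < ln (K * d) - M * P * K / eta).
{ apply Rlt_le_trans with (ln (K * d * exp (- (M * P * K / eta)))).
  - apply ln_increasing; lra.
  - rewrite ln_mult, ln_exp by (try apply exp_pos; lra); lra. }
assert (HeK : 0 < eta / K) by (apply Rdiv_lt_0_compat; lra).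
assert (E : M * P = eta / K * (M * P * K / eta)) by (field; split; lra).
unfold plus; simpl.
assert (Q : eta / K * (M * P * K / eta) < eta / K * (ln (K * d + eps) - ln eps))
  by (apply Rmult_lt_compat_l; lra).
lra.
Qed.

(** * Periodic linear equations and scalar flows *)

Lemma derive_zero_everywhere (f : R -> R) :
  (forall x, is_derive f x 0) -> forall x y, f x = f y.
Proof.
intros D x y; destruct (Rle_lt_dec x y);
  [| symmetry]; apply derive_zero_const; auto; lra.
Qed.

Lemma derive_shift (f : R -> R) (P x l : R) :
  is_derive f (x + P) l -> is_derive (fun y => f (y + P)) x l.
Proof.
intros D; replace l with (scal 1 l) by (unfold scal; simpl; unfold mult; simpl; ring).
apply (is_derive_comp f (fun y => y + P)); [exact D |].
auto_derive; [trivial | ring].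
Qed.

Lemma primitive_derive (k : R -> R) (x0 : R) :
  (forall x, continuous k x) -> forall x, is_derive (fun x => RInt k x0 x) x (k x).
Proof.
intros Ck x; apply is_derive_RInt with x0; [| apply Ck].
apply filter_forall; intros y; apply (RInt_correct (V := R_CompleteNormedModule)).
apply (ex_RInt_continuous (V := R_CompleteNormedModule)); intros; apply Ck.
Qed.

Lemma primitive_shift (k : R -> R) (P x0 : R) :
  (forall x, continuous k x) -> (forall x, k (x + P) = k x) ->
  forall x, RInt k x0 (x + P) = RInt k x0 x + RInt k x0 (x0 + P).
Proof.
intros Ck Hper x.
assert (E := derive_zero_everywhere (fun y => RInt k x0 (y + P) - RInt k x0 y)).
assert (E' : RInt k x0 (x + P) - RInt k x0 x = RInt k x0 (x0 + P) - RInt k x0 x0).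
{ apply E; intros y.
  replace 0 with (minus (k (y + P)) (k y))
    by (rewrite Hper; unfold minus, plus, opp; simpl; ring).
  apply @is_derive_minus; [| now apply primitive_derive].
  apply (derive_shift (fun z => RInt k x0 z)); now apply primitive_derive. }
rewrite RInt_point in E'; unfold zero in E'; simpl in E'; lra.
Qed.

(** The solution is the inverse function of the time tau needed to go from 0 to a
    given point, the primitive of 1/Y.  By the mean value theorem an increment of
    the inverse is Y at an intermediate point times the increment of time. *)
Lemma positive_scalar_flow (Y : R -> R) (P : R) :
  0 < P -> (forall x, continuous Y x) -> (forall x, 0 < Y x) ->
  (forall x, Y (x + P) = Y x) ->
  exists (Theta : R -> R) (T : R), 0 < T /\
    (forall t, is_derive Theta t (Y (Theta t))) /\
    (forall t, Theta (t + T) = Theta t + P) /\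
    (forall x, exists t, Theta t = x).
Proof.
intros HP CY HY HYP.
pose (k := fun x => / Y x).
assert (Ck : forall x, continuous k x).
{ intros x; apply continuous_Rinv_comp; [apply CY | specialize (HY x); lra]. }
assert (Hk : forall x, 0 < k x) by (intros x; apply Rinv_0_lt_compat, HY).
pose (tau := (fun x => RInt k 0 x) : R -> R).
assert (Dtau : forall x, is_derive tau x (k x)) by (intros; now apply primitive_derive).
assert (Hinc : forall x y, x < y -> tau x < tau y).
{ intros x y Hxy; apply derive_pos_increasing with k; auto. }
pose (T := tau (0 + P)).
assert (HT : 0 < T).
{ replace 0 with (tau 0) by (unfold tau; rewrite RInt_point; reflexivity).
  apply Hinc; lra. }
assert (Hshift : forall x, tau (x + P) = tau x + T).
{ apply primitive_shift; [exact Ck |]; intros x; unfold k; now rewrite HYP. }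
assert (Hinj : forall x y, tau x = tau y -> x = y).
{ intros x y E; destruct (Rtotal_order x y) as [H | [H | H]]; [| exact H |];
    apply Hinc in H; lra. }
assert (Hsurj : forall t, exists x, tau x = t).
{ intros t; destruct (period_representative T 0 t HT) as [j Hj].
  destruct (IVT_gen tau 0 P (t + IZR j * T)) as [x [_ Hx]].
  - intros x; apply continuity_pt_filterlim, (ex_derive_continuous tau).
    exists (k x); apply Dtau.
  - assert (tau 0 = 0) by (unfold tau; rewrite RInt_point; reflexivity).
    assert (tau P = T) by (unfold T; now rewrite Rplus_0_l).
    rewrite Rmin_left, Rmax_right by lra; lra.
  - exists (x + IZR (- j) * P).
    rewrite (period_iterate tau P T Hshift), Hx, opp_IZR; lra. }
pose (Theta := fun t => proj1_sig (constructive_indefinite_description _ (Hsurj t))).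
assert (HTheta : forall t, tau (Theta t) = t).
{ intros t; exact (proj2_sig (constructive_indefinite_description _ (Hsurj t))). }
assert (HM : exists M, 0 < M /\ forall x, Y x <= M).
{ destruct (continuous_bounded Y 0 P) as [M [HM HB]]; [intros; apply CY |].
  exists M; split; [exact HM |]; intros x.
  destruct (period_representative P 0 x HP) as [j Hj].
  replace (Y x) with (Y (x + IZR j * P)); [apply HB; lra |].
  rewrite (period_iterate Y P 0); [ring |]; intros; rewrite HYP; ring. }
destruct HM as [M [HM HYM]].
assert (Hmv : forall t s, exists xi,
  Rmin (Theta t) (Theta s) <= xi <= Rmax (Theta t) (Theta s) /\
  Theta s - Theta t = Y xi * (s - t)).
{ intros t s.
  destruct (MVT_gen tau (Theta t) (Theta s) k) as [xi [Hxi E]].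
  - intros; apply Dtau.
  - intros x _; apply continuity_pt_filterlim, (ex_derive_continuous tau).
    exists (k x); apply Dtau.
  - exists xi; split; [exact Hxi |].
    rewrite !HTheta in E; rewrite E; unfold k; specialize (HY xi); field; lra. }
exists Theta, T; split; [| split; [| split]].
- exact HT.
- intros t; apply is_derive_Reals; intros e He.
  destruct (continuous_eps Y (Theta t) (CY _) e He) as [d [Hd Hnear]].
  assert (HdM : 0 < d / M) by (apply Rdiv_lt_0_compat; assumption).
  exists (mkposreal _ HdM); intros h Hh0 Hh; simpl in Hh.
  destruct (Hmv t (t + h)) as [xi [Hxi E]].
  replace (t + h - t) with h in E by ring.
  rewrite E; replace (Y xi * h / h) with (Y xi) by (field; exact Hh0).
  apply Hnear.
  apply Rle_lt_trans with (Rabs (Theta (t + h) - Theta t)).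
  { revert Hxi; unfold Rmin, Rmax, Rabs.
    destruct (Rle_dec _ _), (Rcase_abs _), (Rcase_abs _); lra. }
  rewrite E, Rabs_mult, (Rabs_right (Y xi)) by (specialize (HY xi); lra).
  apply Rle_lt_trans with (M * Rabs h).
  { apply Rmult_le_compat_r; [apply Rabs_pos | apply HYM]. }
  replace d with (M * (d / M)) by (field; lra).
  apply Rmult_lt_compat_l; assumption.
- intros t; apply Hinj; rewrite Hshift, !HTheta; reflexivity.
- intros x; exists (tau x); apply Hinj, HTheta.
Qed.

(** For negative Y the flow is that of the reflected field - Y (- x). *)
Lemma scalar_flow (Y : R -> R) (P sigma : R) :
  0 < P -> sigma = 1 \/ sigma = -1 ->
  (forall x, continuous Y x) -> (forall x, 0 < sigma * Y x) ->
  (forall x, Y (x + P) = Y x) ->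
  exists (Theta : R -> R) (T : R), 0 < T /\
    (forall t, is_derive Theta t (Y (Theta t))) /\
    (forall t, Theta (t + T) = Theta t + sigma * P) /\
    (forall x, exists t, Theta t = x).
Proof.
intros HP Hsg CY HY HYP.
destruct Hsg as [-> | ->].
- destruct (positive_scalar_flow Y P) as [Theta [T [H1 [H2 [H3 H4]]]]]; auto.
  { intros x; specialize (HY x); lra. }
  exists Theta, T; split; [| split; [| split]]; auto.
  intros t; rewrite H3; ring.
- destruct (positive_scalar_flow (fun x => - Y (- x)) P)
    as [Theta [T [H1 [H2 [H3 H4]]]]].
  + exact HP.
  + intros x; apply @continuous_opp.
    apply (continuous_comp (fun x => - x) Y); [| apply CY].
    apply @continuous_opp, continuous_id.
  + intros x; specialize (HY (- x)); lra.
  + intros x; rewrite <- (HYP (- (x + P))); do 2 f_equal; ring.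
  + exists (fun t => - Theta t), T; split; [| split; [| split]].
    * exact H1.
    * intros t.
      replace (Y (- Theta t)) with (opp (- Y (- Theta t)))
        by (unfold opp; simpl; ring).
      apply @is_derive_opp; apply H2.
    * intros t; rewrite H3; ring.
    * intros x; destruct (H4 (- x)) as [t Ht]; exists t; lra.
Qed.

(** Variation of constants.  With E = exp A, the quotient w = V/E of the
    periodic solution satisfies w' = h/E and w(x+P) = exp(-K) w(x); as h and K
    have opposite signs, w is monotone in the direction that makes this
    possible for positive w only. *)
Lemma periodic_linear_equation (k h : R -> R) (P x0 : R) :
  0 < P ->
  (forall x, continuous k x) -> (forall x, k (x + P) = k x) ->
  (forall x, continuous h x) -> (forall x, h (x + P) = h x) ->
  (forall x, h x * RInt k x0 (x0 + P) < 0) ->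
  exists A V : R -> R,
    (forall x, is_derive A x (k x)) /\
    (forall x, A (x + P) = A x + RInt k x0 (x0 + P)) /\
    (forall x, is_derive V x (h x + k x * V x)) /\
    (forall x, V (x + P) = V x) /\
    (forall x, 0 < V x).
Proof.
intros HP Ck Pk Ch Ph Hsign.
pose (A := (fun x => RInt k x0 x) : R -> R).
set (K := RInt k x0 (x0 + P)) in *.
assert (DA : forall x, is_derive A x (k x)) by (intros; now apply primitive_derive).
assert (SA : forall x, A (x + P) = A x + K) by now apply primitive_shift.
pose (q := fun x => h x * exp (- A x)).
assert (Cq : forall x, continuous q x).
{ intros x; apply @continuous_mult; [apply Ch |].
  apply (continuous_comp (fun x => - A x) exp).
  - apply @continuous_opp, (ex_derive_continuous A); exists (k x); apply DA.
  - apply (ex_derive_continuous exp); exists (exp (- A x)); apply is_derive_exp. }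
pose (kappa := exp K).
assert (Hkappa : 0 < kappa) by apply exp_pos.
assert (HK : K <> 0) by (intros E; specialize (Hsign 0); rewrite E in Hsign; lra).
assert (Hkappa1 : kappa <> 1).
{ unfold kappa; intros E; rewrite <- exp_0 in E; apply HK, exp_inv, E. }
pose (I := RInt q x0 (x0 + P)).
(* the constant is the one for which w (x0 + P) * kappa = w x0 *)
pose (w := fun x => kappa * I / (1 - kappa) + RInt q x0 x).
assert (Dw : forall x, is_derive w x (q x)).
{ intros x; replace (q x) with (plus 0 (q x)) by (unfold plus; simpl; ring).
  apply @is_derive_plus; [apply @is_derive_const | now apply primitive_derive]. }
assert (qP : forall x, q (x + P) = q x / kappa).
{ intros x; unfold q, kappa; rewrite Ph, SA, Ropp_plus_distr, exp_plus, (exp_Ropp K).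
  unfold Rdiv; ring. }
assert (wP : forall x, w (x + P) * kappa = w x).
{ intros x.
  assert (E : w (x + P) * kappa - w x = w (x0 + P) * kappa - w x0).
  { apply (derive_zero_everywhere (fun y => w (y + P) * kappa - w y)).
    intros y; replace 0 with (minus (q (y + P) * kappa) (q y))
      by (rewrite qP; unfold minus, plus, opp; simpl; field; lra).
    apply @is_derive_minus; [| apply Dw].
    apply (@is_derive_scal_l R_AbsRing R_NormedModule (fun z => w (z + P))).
    now apply derive_shift. }
  assert (E0 : w (x0 + P) * kappa - w x0 = 0); [| lra].
  unfold w; fold I; rewrite RInt_point; unfold zero; simpl; field; lra. }
assert (Hw : forall x, 0 < w x).
{ intros x; specialize (wP x).
  assert (Hq : forall y, q y * K < 0).
  { intros y; unfold q; pose proof (exp_pos (- A y)); specialize (Hsign y); nra. }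
  destruct (Rlt_le_dec K 0) as [HK' | HK'].
  - assert (w x < w (x + P)).
    { apply derive_pos_increasing with q; [lra |].
      intros y _; split; [apply Dw | specialize (Hq y); nra]. }
    assert (kappa < 1) by (unfold kappa; rewrite <- exp_0; apply exp_increasing, HK').
    nra.
  - assert (- w x < - w (x + P)).
    { apply derive_pos_increasing with (f := fun y => - w y) (df := fun y => - q y); [lra |].
      intros y _; split; [apply @is_derive_opp, Dw | specialize (Hq y); nra]. }
    assert (1 < kappa) by (unfold kappa; rewrite <- exp_0; apply exp_increasing; lra).
    nra. }
exists A, (fun x => w x * exp (A x)); split; [| split; [| split; [| split]]]; auto.
- intros x.
  assert (D : is_derive (fun x => w x * exp (A x)) x
    (q x * exp (A x) + w x * (k x * exp (A x)))).
  { generalize (Dw x), (DA x); generalize (q x), (k x); clearbody w A.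
    intros dw dA D1 D2; auto_derive.
    - repeat split; [exists dw; exact D1 | exists dA; exact D2].
    - rewrite (Derive_eta _ _ _ D1), (Derive_eta _ _ _ D2); ring. }
  replace (h x + k x * (w x * exp (A x))) with (q x * exp (A x) + w x * (k x * exp (A x)));
    [exact D |].
  unfold q; rewrite exp_Ropp; pose proof (exp_pos (A x)); field; lra.
- intros x; rewrite SA, exp_plus; fold kappa; rewrite <- (wP x); ring.
- intros x; apply Rmult_lt_0_compat; [apply Hw | apply exp_pos].
Qed.

(** The squared norm w satisfies w' = 2 w (lambda + r^N f), so if it vanishes once
    it vanishes always, by Gronwall. *)
Lemma solution_avoids_origin (lambda : R) (N : nat) (a b : nat -> R)
    (psi : R -> R * R) :
  complete_solution (field lambda (S N) a b) psi ->
  psi 0 <> (0, 0) -> forall t, psi t <> (0, 0).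
Proof.
intros Hpsi H0 t Ht.
pose (w := fun s => rad (psi s) * rad (psi s)).
assert (Cr : forall s, continuous (fun s => rad (psi s)) s).
{ intros s; apply rad_continuous; now apply solution_continuous with (field lambda (S N) a b). }
destruct (continuous_bounded (fun s => rad (psi s)) (Rmin t 0) (Rmax t 0)) as [B [HB HBr]].
{ intros; apply Cr. }
destruct (radial_lip (S N) a b) as [Kf [HKf Hf]].
assert (Z : w 0 = 0).
{ apply (gronwall_zero w (fun s => 2 * (fst (psi s) * fst (field lambda (S N) a b (psi s))
      + snd (psi s) * snd (field lambda (S N) a b (psi s))))
    (2 * (Rabs lambda + B ^ N * Kf)) t 0).
  - intros s Hs; split.
    + assert (Dx := derive_fst _ _ _ (Hpsi s)); assert (Dy := derive_snd _ _ _ (Hpsi s)).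
      apply is_derive_ext with (fun s => fst (psi s) * fst (psi s) + snd (psi s) * snd (psi s)).
      { intros r; symmetry; apply rad_sqr. }
      assert (G : forall (x y : R -> R) dx dy, is_derive x s dx -> is_derive y s dy ->
        is_derive (fun r => x r * x r + y r * y r) s (2 * (x s * dx + y s * dy))).
      { intros x y dx dy D1 D2; auto_derive.
        - repeat split; first [exists dx; exact D1 | exists dy; exact D2].
        - rewrite (Derive_eta _ _ _ D1), (Derive_eta _ _ _ D2); ring. }
      exact (G _ _ _ _ Dx Dy).
    + destruct (classic (psi s = (0, 0))) as [E | Hnz].
      * assert (Ew : w s = 0) by (unfold w; rewrite rad_sqr, E; simpl; ring).
        rewrite E, Ew; simpl fst at 1; simpl snd at 2.
        rewrite !Rmult_0_l, Rplus_0_l, Rmult_0_r, Rabs_R0; lra.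
      * assert (Hr := rad_pos _ Hnz).
        destruct (angle_exists _ Hnz) as [th E].
        assert (Hval : fst (psi s) * fst (field lambda (S N) a b (psi s))
          + snd (psi s) * snd (field lambda (S N) a b (psi s))
          = (lambda + rad (psi s) ^ N * radial (S N) a b th) * w s).
        { unfold w; rewrite E at 1 2 3 4; unfold field.
          rewrite (form_frame_fst _ a b), (form_frame_snd _ a b); simpl fst; simpl snd.
          set (r := rad (psi s)); set (f := radial (S N) a b th).
          set (g := angular (S N) a b th); simpl (r ^ S N).
          transitivity ((lambda + r ^ N * f) * (r * r)
            * (cos th * cos th + sin th * sin th)); [ring | rewrite cos_sin_sq; ring]. }
        rewrite Hval, Rabs_mult, (Rabs_right 2), Rabs_mult by lra.
        rewrite <- Rmult_assoc; apply Rmult_le_compat_r; [apply Rabs_pos |].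
        apply Rmult_le_compat_l; [lra |].
        apply Rle_trans with (1 := Rabs_triang _ _); apply Rplus_le_compat_l.
        rewrite Rabs_mult; apply Rmult_le_compat; try apply Rabs_pos; [| apply (Hf th th)].
        rewrite Rabs_right by (apply Rle_ge, pow_le; lra).
        apply pow_incr; split; [lra | apply HBr, Hs].
  - unfold w; rewrite rad_sqr, Ht; simpl; ring. }
pose proof (rad_pos _ H0); unfold w in Z; nra.
Qed.

(** * The limit cycle *)

Lemma exp_pow_nat (x : R) (n : nat) : exp x ^ n = exp (INR n * x).
Proof.
induction n as [|n IH]; [simpl; rewrite Rmult_0_l, exp_0; reflexivity |].
simpl pow; rewrite IH, S_INR, <- exp_plus; f_equal; ring.
Qed.

Lemma derive_root (V : R -> R) (N : nat) (x dV : R) :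
  (0 < N)%nat -> 0 < V x -> is_derive V x dV ->
  is_derive (fun y => exp (ln (V y) / INR N)) x
    (exp (ln (V x) / INR N) * (dV / (INR N * V x))).
Proof.
intros HN HV D.
assert (0 < INR N) by now apply lt_0_INR.
auto_derive.
- repeat split; [exists dV; exact D | exact HV].
- rewrite (Derive_eta _ _ _ D); unfold Rdiv at 1; field; split; lra.
Qed.

Lemma derive_polar (r th : R -> R) (t dr dth : R) :
  is_derive r t dr -> is_derive th t dth ->
  is_derive (fun s => polar (r s) (th s)) t
    (dr * cos (th t) - r t * (dth * sin (th t)), dr * sin (th t) + r t * (dth * cos (th t))).
Proof.
intros Dr Dth; apply derive_pair.
- auto_derive; [repeat split; [exists dr; exact Dr | exists dth; exact Dth] |].
  rewrite (Derive_eta _ _ _ Dr), (Derive_eta _ _ _ Dth); ring.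
- auto_derive; [repeat split; [exists dr; exact Dr | exists dth; exact Dth] |].
  rewrite (Derive_eta _ _ _ Dr), (Derive_eta _ _ _ Dth); ring.
Qed.

Lemma open_punctured_plane : open (fun p : R * R => 0 < fst p * fst p + snd p * snd p).
Proof.
apply (open_comp (fun p : R * R => fst p * fst p + snd p * snd p) (fun x => 0 < x)).
- intros p _.
  apply (continuous_plus (fun p : R * R => fst p * fst p) (fun p : R * R => snd p * snd p)).
  + apply (continuous_mult (fun p : R * R => fst p) (fun p : R * R => fst p));
      apply continuous_fst.
  + apply (continuous_mult (fun p : R * R => snd p) (fun p : R * R => snd p));
      apply continuous_snd.
- apply open_gt.
Qed.

Lemma derive_weighted_gap (v B A : R -> R) (t dv dB dA : R) :
  is_derive v t dv -> is_derive B t dB -> is_derive A t dA ->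
  is_derive (fun s => (v s - B s) * exp (- A s)) t
    ((dv - dB - (v t - B t) * dA) * exp (- A t)).
Proof.
intros Dv DB DA; auto_derive.
- repeat split; [exists dv; exact Dv | exists dB; exact DB | exists dA; exact DA].
- rewrite (Derive_eta _ _ _ Dv), (Derive_eta _ _ _ DB), (Derive_eta _ _ _ DA); ring.
Qed.

Lemma derive_power (r : R -> R) (N : nat) (t dr : R) :
  is_derive r t dr -> is_derive (fun s => r s ^ N) t (INR N * dr * r t ^ pred N).
Proof.
intros D; auto_derive; [exists dr; exact D |].
rewrite (Derive_eta _ _ _ D); ring.
Qed.

Lemma derive_chain (f u : R -> R) (t df du : R) :
  is_derive f (u t) df -> is_derive u t du -> is_derive (fun s => f (u s)) t (df * du).
Proof.
intros Df Du; replace (df * du) with (scal du df)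
  by (unfold scal; simpl; unfold mult; simpl; ring).
apply (is_derive_comp f u); assumption.
Qed.

(** Along any orbit, v = r^N as a function of the angle solves the same linear
    equation as V, so (v - V) exp (- A) is a constant.  Over one period the angle
    changes by a nonzero multiple 2 pi j, which multiplies this constant by
    exp (- j K), different from 1; so the constant is zero and the orbit lies on
    r^N = V.  The last two conclusions say that the orbit makes at least one full
    turn. *)
Lemma periodic_orbit_unique (lambda : R) (N : nat) (a b : nat -> R) (sigma K : R)
    (A V : R -> R) (psi : R -> R * R) (T : R) :
  (0 < N)%nat -> sigma = 1 \/ sigma = -1 ->
  (forall th, 0 < sigma * angular (S N) a b th) -> K <> 0 ->
  (forall th, is_derive A th (INR N * radial (S N) a b th / angular (S N) a b th)) ->
  (forall th, A (th + 2 * PI) = A th + K) ->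
  (forall th, is_derive V th (INR N * lambda / angular (S N) a b th
     + INR N * radial (S N) a b th / angular (S N) a b th * V th)) ->
  (forall th, V (th + 2 * PI) = V th) ->
  complete_solution (field lambda (S N) a b) psi -> 0 < T ->
  (forall t, psi (t + T) = psi t) -> ~ equilibrium (field lambda (S N) a b) (psi 0) ->
  exists (th : R -> R) (lo : R), (forall s, continuous th s) /\
    (forall s, 0 <= s <= T -> psi s = polar (rad (psi s)) (th s)
       /\ 0 < rad (psi s) /\ rad (psi s) ^ N = V (th s)) /\
    Rmin (th 0) (th T) <= lo /\ lo + 2 * PI <= Rmax (th 0) (th T).
Proof.
intros HN Hsg Hg HK DA PA DV PV Hpsi HT HperT Hneq.
set (f := radial (S N) a b) in *; set (g := angular (S N) a b) in *.
pose proof PI_RGT_0 as HPI.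
assert (Hg0 : forall x, g x <> 0) by (intros x E; specialize (Hg x); rewrite E in Hg; lra).
assert (Hnz : forall t, psi t <> (0, 0)).
{ apply (solution_avoids_origin lambda N a b); [exact Hpsi |].
  intros E; apply Hneq; rewrite E; apply field_origin; lia. }
destruct (angle_lift_exists psi (-1) (T + 1)) as [th L].
{ now apply solution_continuous with (field lambda (S N) a b). }
{ exact Hnz. }
{ lra. }
assert (Hmot : forall t, 0 <= t <= T ->
  is_derive th t (rad (psi t) ^ N * g (th t)) /\
  is_derive (fun s => rad (psi s)) t (lambda * rad (psi t) + rad (psi t) ^ S N * f (th t))).
{ intros t Ht; apply (polar_motion lambda N a b psi th (-1) (T + 1)); auto; lra. }
assert (Hr : forall t, 0 < rad (psi t)) by (intros; apply rad_pos, Hnz).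
pose (D := fun t => (rad (psi t) ^ N - V (th t)) * exp (- A (th t))).
assert (HD : forall t, 0 <= t <= T -> is_derive D t 0).
{ intros t Ht; destruct (Hmot t Ht) as [Dth Dr].
  assert (DD := derive_weighted_gap _ _ _ t _ _ _
    (derive_power _ N t _ Dr)
    (derive_chain V th t _ _ (DV (th t)) Dth)
    (derive_chain A th t _ _ (DA (th t)) Dth)).
  cbv beta in DD.
  match type of DD with is_derive _ _ ?l => replace l with 0 in DD end; [exact DD |].
  replace (rad (psi t) ^ S N) with (rad (psi t) * rad (psi t) ^ N) by reflexivity.
  destruct N as [|N']; [lia |]; simpl pred.
  simpl (rad (psi t) ^ S N'); field; apply Hg0. }
assert (Hconst : forall t, 0 <= t <= T -> D 0 = D t).
{ intros t Ht; apply derive_zero_const; [lra |]; intros; apply HD; lra. }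
assert (HpsiT : psi T = psi 0) by (rewrite <- (HperT 0); f_equal; ring).
destruct (polar_same_angle (rad (psi 0)) (rad (psi 0)) (th 0) (th T)) as [j Hj];
  try apply Hr.
{ rewrite <- (proj2 L 0) by lra; rewrite <- HpsiT; apply L; lra. }
assert (Hmono : sigma * th 0 < sigma * th T).
{ apply derive_pos_increasing with (f := fun t => sigma * th t)
    (df := fun t => sigma * (rad (psi t) ^ N * g (th t))); [exact HT |].
  intros t Ht; split.
  - apply (is_derive_scal th t sigma), Hmot, Ht.
  - assert (0 < rad (psi t) ^ N) by apply pow_lt, Hr.
    specialize (Hg (th t)); nra. }
assert (Hj0 : j <> 0%Z) by (intros ->; rewrite Hj in Hmono; lra).
assert (HD0 : D 0 = 0).
{ assert (E := Hconst T ltac:(lra)); unfold D in E.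
  rewrite HpsiT, Hj, (period_iterate A (2 * PI) K PA), (period_iterate V (2 * PI) 0) in E
    by (intros; rewrite PV; ring).
  rewrite Rmult_0_r, Rplus_0_r, Ropp_plus_distr, exp_plus in E; fold (D 0) in E.
  assert (exp (- (IZR j * K)) <> 1).
  { rewrite <- exp_0; intros Ee; apply exp_inv in Ee.
    assert (Z : IZR j * K = 0) by lra.
    apply Rmult_integral in Z; destruct Z as [Z | Z]; [| easy].
    apply Hj0, eq_IZR, Z. }
  assert (E' : D 0 * (1 - exp (- (IZR j * K))) = 0) by (unfold D at 1; unfold D in E; lra).
  apply Rmult_integral in E'; destruct E'; [assumption | lra]. }
assert (Hgap : exists lo, Rmin (th 0) (th T) <= lo /\ lo + 2 * PI <= Rmax (th 0) (th T)).
{ exists (Rmin (th 0) (th T)); split; [lra |].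
  destruct (Z_lt_le_dec 0 j) as [Hpos | Hneg].
  - assert (1 <= IZR j) by (apply IZR_le; lia).
    assert (2 * PI <= IZR j * (2 * PI)) by nra.
    rewrite Rmin_left, Rmax_right; lra.
  - assert (IZR j <= -1) by (apply IZR_le; lia).
    assert (IZR j * (2 * PI) <= - (2 * PI)) by nra.
    rewrite Rmin_right, Rmax_left; lra. }
destruct Hgap as [lo Hlo].
exists th, lo; split; [apply L | split; [| exact Hlo]].
intros s Hs; split; [apply L; lra | split; [apply Hr |]].
assert (E := Hconst s Hs); rewrite HD0 in E; unfold D in E.
pose proof (exp_pos (- A (th s))).
symmetry in E; apply Rmult_integral in E; destruct E; lra.
Qed.

(** The closed curve r^N = V(theta), run through with angular speed V g, is a
    periodic orbit, and it is the only one off the origin; the punctured plane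
    therefore serves as the isolating neighbourhood.  The sign condition of the
    linear equation is the negativity of the integral, as h and K are positive
    multiples of sigma lambda and of sigma / lambda times the integral. *)
Lemma limit_cycle_exists (lambda : R) (N : nat) (a b : nat -> R) (sigma th0 : R) :
  lambda <> 0 -> (0 < N)%nat -> sigma = 1 \/ sigma = -1 ->
  (forall th, 0 < sigma * angular (S N) a b th) ->
  RInt (fun th => lambda * radial (S N) a b th / (sigma * angular (S N) a b th))
    th0 (th0 + 2 * PI) < 0 ->
  exists G, limit_cycle (field lambda (S N) a b) G.
Proof.
intros Hl HN Hsg Hg Hint.
set (f := radial (S N) a b) in *; set (g := angular (S N) a b) in *.
pose proof PI_RGT_0 as HPI.
assert (HNR : 0 < INR N) by now apply lt_0_INR.
assert (Hs2 : sigma * sigma = 1) by (destruct Hsg as [-> | ->]; ring).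
assert (Hs0 : sigma <> 0) by (intros E; rewrite E in Hs2; lra).
assert (Hg0 : forall x, g x <> 0) by (intros x E; specialize (Hg x); rewrite E in Hg; lra).
assert (Cf : forall x, continuous f x) by (intros; apply lip_continuous, radial_lip).
assert (Cg : forall x, continuous g x) by (intros; apply lip_continuous, angular_lip).
assert (Pf : forall x, f (x + 2 * PI) = f x).
{ intros x; unfold f; rewrite <- (radial_period (S N) a b x 1), Rmult_1_l; reflexivity. }
assert (Pg : forall x, g (x + 2 * PI) = g x).
{ intros x; unfold g; rewrite <- (angular_period (S N) a b x 1), Rmult_1_l; reflexivity. }
pose (k := fun x => INR N * f x / g x).
pose (h := fun x => INR N * lambda / g x).
assert (Ck : forall x, continuous k x).
{ intros x; apply @continuous_mult; [| now apply continuous_Rinv_comp].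
  apply @continuous_mult; [apply continuous_const | apply Cf]. }
assert (Ch : forall x, continuous h x).
{ intros x; apply @continuous_mult; [apply continuous_const |].
  now apply continuous_Rinv_comp. }
pose (K := RInt k th0 (th0 + 2 * PI)).
assert (HK : K = INR N * sigma / lambda
  * RInt (fun th => lambda * f th / (sigma * g th)) th0 (th0 + 2 * PI)).
{ unfold K; rewrite <- (RInt_scal (V := R_CompleteNormedModule)).
  - apply RInt_ext; intros x _; unfold k, scal; simpl; unfold mult; simpl.
    field; repeat split; auto.
  - apply (ex_RInt_continuous (V := R_CompleteNormedModule)); intros x _.
    apply @continuous_mult; [apply @continuous_mult; [apply continuous_const | apply Cf] |].
    apply continuous_Rinv_comp; [| specialize (Hg x); lra].
    apply @continuous_mult; [apply continuous_const | apply Cg]. }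
set (J := RInt _ _ _) in Hint, HK.
assert (Hsign : forall x, h x * K < 0).
{ intros x; rewrite HK; unfold h.
  replace (INR N * lambda / g x * (INR N * sigma / lambda * J))
    with (- ((INR N * INR N) * / (sigma * g x) * - J)).
  - assert (0 < / (sigma * g x)) by apply Rinv_0_lt_compat, Hg.
    assert (0 < INR N * INR N) by nra.
    assert (0 < INR N * INR N * / (sigma * g x)) by now apply Rmult_lt_0_compat.
    nra.
  - replace (/ (sigma * g x)) with (sigma * / g x); [field; split; auto |].
    rewrite Rinv_mult; replace (/ sigma) with sigma; [reflexivity |].
    apply Rmult_eq_reg_l with sigma; [rewrite Hs2; field; exact Hs0 | exact Hs0]. }
assert (HK0 : K <> 0) by (intros E; specialize (Hsign 0); rewrite E in Hsign; lra).
destruct (periodic_linear_equation k h (2 * PI) th0) as [A [V [DA [PA [DV [PV HV]]]]]];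
  [lra | exact Ck | intros; unfold k; now rewrite Pf, Pg | exact Ch
  | intros; unfold h; now rewrite Pg | exact Hsign |].
fold K in PA.
assert (CV : forall x, continuous V x).
{ intros x; apply (ex_derive_continuous V); eexists; apply DV. }
destruct (scalar_flow (fun x => V x * g x) (2 * PI) sigma)
  as [Theta [T [HT [DTheta [PTheta STheta]]]]].
{ lra. }
{ exact Hsg. }
{ intros x; apply @continuous_mult; [apply CV | apply Cg]. }
{ intros x; specialize (HV x); specialize (Hg x).
  replace (sigma * (V x * g x)) with (V x * (sigma * g x)) by ring; nra. }
{ intros x; now rewrite PV, Pg. }
pose (rho := fun x => exp (ln (V x) / INR N)).
assert (Hrho : forall x, 0 < rho x) by (intros; apply exp_pos).
assert (HrhoN : forall x, rho x ^ N = V x).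
{ intros x; unfold rho; rewrite exp_pow_nat.
  replace (INR N * (ln (V x) / INR N)) with (ln (V x)) by (field; lra).
  apply exp_ln, HV. }
pose (phi := fun t => polar (rho (Theta t)) (Theta t)).
assert (Hphi : complete_solution (field lambda (S N) a b) phi).
{ intros t.
  assert (Dr := derive_chain rho Theta t _ _
    (derive_root V N (Theta t) _ HN (HV _) (DV _)) (DTheta t)).
  assert (D := derive_polar _ _ t _ _ Dr (DTheta t)).
  match type of D with is_derive _ _ ?l =>
    replace (field lambda (S N) a b (phi t)) with l end; [exact D |].
  fold (rho (Theta t)); unfold field, phi.
  rewrite (form_frame_fst _ a b), (form_frame_snd _ a b).
  simpl fst; simpl snd; fold f g; simpl (rho (Theta t) ^ S N); rewrite HrhoN.
  unfold h, k; specialize (HV (Theta t)).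
  f_equal; field; repeat split; try apply Hg0; lra. }
assert (Prho : forall x (j : Z), rho (x + IZR j * (2 * PI)) = rho x).
{ intros x j; unfold rho; rewrite (period_iterate V (2 * PI) 0);
    [| intros; rewrite PV; ring].
  now rewrite Rmult_0_r, Rplus_0_r. }
assert (Pgam : forall x (j : Z),
  polar (rho (x + IZR j * (2 * PI))) (x + IZR j * (2 * PI)) = polar (rho x) x).
{ intros x j; rewrite Prho; apply polar_add_two_pi. }
assert (Horbit : periodic_orbit (field lambda (S N) a b) (image phi)).
{ exists phi, T; split; [exact Hphi | split; [exact HT | split; [| split]]].
  - intros t; unfold phi; rewrite PTheta.
    destruct Hsg as [-> | ->]; [apply (Pgam (Theta t) 1%Z) | apply (Pgam (Theta t) (-1)%Z)].
  - unfold phi; rewrite equilibrium_polar by apply Hrho.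
    intros [_ E]; now apply Hg0 in E.
  - reflexivity. }
exists (image phi); split; [exact Horbit |].
exists (fun p => 0 < fst p * fst p + snd p * snd p).
split; [exact open_punctured_plane | split].
- intros p [t <-]; apply sqr_sum_pos, polar_nonzero, Hrho.
- intros G' [psi [T' [Hpsi [HT' [Pp [Hneq HG']]]]]] _ p.
  destruct (periodic_orbit_unique lambda N a b sigma K A V psi T') as
    [th [lo [Cth [Hth [Hlo Hhi]]]]]; try assumption.
  assert (Hcurve : forall s, 0 <= s <= T' -> psi s = polar (rho (th s)) (th s)).
  { intros s Hs; destruct (Hth s Hs) as [E [Hr Hv]].
    rewrite E; f_equal; apply pow_inj_pos with N; auto.
    now rewrite HrhoN. }
  rewrite HG'; split.
  + intros [t <-].
    destruct (period_representative T' 0 t HT') as [j Hj].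
    rewrite <- (period_iterate_curve psi T' Pp j t), Hcurve by lra.
    destruct (STheta (th (t + IZR j * T'))) as [s Es].
    exists s; unfold phi; now rewrite Es.
  + intros [t <-].
    destruct (period_representative (2 * PI) lo (Theta t)) as [j Hj]; [lra |].
    destruct (IVT_gen th 0 T' (Theta t + IZR j * (2 * PI))) as [s [Hs Es]].
    { intros s; apply continuity_pt_filterlim, Cth. }
    { lra. }
    rewrite Rmin_left, Rmax_right in Hs by lra.
    exists s; rewrite Hcurve, Es by lra; apply Pgam.
Qed.

Theorem proposition5p9 (lambda : R) (hlambda : lambda <> 0)
    (n : nat) (hn : (1 < n)%nat)
    (a b : nat -> R) (hQ1 : nonzero_form n a) (hQ2 : nonzero_form n b)
    (hcycle : exists c : R -> R * R,
       heteroclinic_cycle (field lambda n a b) c) :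
  exists A B : R -> nat -> R,
    continuous_family n A /\ continuous_family n B /\
    form_eq n (A 0) a /\ form_eq n (B 0) b /\
    exists eps0 : R, 0 < eps0 /\
      forall eps : R, 0 < eps < eps0 ->
        exists G : R * R -> Prop,
          limit_cycle (field lambda n (A eps) (B eps)) G.
Proof.
destruct hcycle as [c Hc].
assert (Hstr : (exists sigma, (sigma = 1 \/ sigma = -1) /\
    forall th, 0 <= sigma * angular n a b th) /\
  (exists th, angular n a b th = 0) /\
  (forall th, angular n a b th = 0 -> lambda * radial n a b th < 0)).
{ destruct n as [|N]; [lia |].
  apply (heteroclinic_structure lambda N a b c); [exact hlambda | lia | exact Hc]. }
destruct Hstr as [[sigma [Hsg Hg]] [[th0 Hth0] Hneg]].
destruct (degree_odd lambda n a b th0 Hth0 Hneg) as [m ->].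
destruct (rotation_forms m) as [d [e Hrot]].
exists (fun eps i => a i + sigma * eps * d i), (fun eps i => b i + sigma * eps * e i).
assert (Hlin : forall p q eps, continuous (fun x : R => p + sigma * x * q) eps).
{ intros p q eps; apply (ex_derive_continuous (fun x => p + sigma * x * q)).
  auto_derive; trivial. }
split; [intros i _ eps; apply Hlin |].
split; [intros i _ eps; apply Hlin |].
split; [intros i _; ring | split; [intros i _; ring |]].
assert (Hs2 : sigma * sigma = 1) by (destruct Hsg as [-> | ->]; ring).
destruct (negative_over_angular_speed (fun th => lambda * radial (S (2 * m)) a b th)
  (fun th => sigma * angular (S (2 * m)) a b th) (2 * PI) th0)
  as [eps0 [Heps0 Hint]].
- pose proof PI_RGT_0; lra.
- apply lip_mult; [apply lip_const | apply radial_lip].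
- apply lip_mult; [apply lip_const | apply angular_lip].
- exact Hg.
- rewrite Hth0; ring.
- intros x Hx; apply Hneg.
  apply Rmult_integral in Hx; destruct Hx as [Hx | Hx]; [| exact Hx].
  rewrite Hx in Hs2; lra.
- exists eps0; split; [exact Heps0 |]; intros eps Heps.
  assert (Hang : forall th, sigma * angular (S (2 * m))
    (fun i => a i + sigma * eps * d i) (fun i => b i + sigma * eps * e i) th
    = sigma * angular (S (2 * m)) a b th + eps).
  { intros th; rewrite (angular_perturbed m a b d e (sigma * eps) th Hrot).
    transitivity (sigma * angular (S (2 * m)) a b th + sigma * sigma * eps);
      [ring | rewrite Hs2; ring]. }
  apply limit_cycle_exists with sigma th0; [exact hlambda | lia | exact Hsg | |].
  + intros th; rewrite Hang; specialize (Hg th); lra.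
  + rewrite <- (RInt_ext (fun th => lambda * radial (S (2 * m)) a b th
      / (sigma * angular (S (2 * m)) a b th + eps))); [now apply Hint |].
    intros th _; rewrite Hang, (radial_perturbed m a b d e (sigma * eps) th Hrot).
    reflexivity.
Qed.
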